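(* Let $\mathbb{K}$ be a field, let $\Omega$ be a nondegenerate extended diassociative semigroup (EDS) and let $V$ be a nonzero $\mathbb{K}$-vector space. The following conditions are equivalent: 1. There exists a unique coproduct $\Delta$ on the dendriform algebra $\mathbb{K}\Omega\otimes\mathrm{Sh}^+_\Omega(V)$, making it a dendriform bialgebra, such that for any $v\in V$ and any $\alpha\in\Omega$, $\Delta(\alpha\otimes v)=0$. 2. $\Omega$ is commutative.
   Context: Extended diassociative semigroups. A diassociative semigroup is a set $\Omega$ with maps $\leftarrow,\rightarrow:\Omega\times\Omega\to\Omega$ such that for all $\alpha,\beta,\gamma\in\Omega$: $(\alpha\leftarrow\beta)\leftarrow\gamma=\alpha\leftarrow(\beta\leftarrow\gamma)=\alpha\leftarrow(\beta\rightarrow\gamma)$; $(\alpha\rightarrow\beta)\leftarrow\gamma=\alpha\rightarrow(\beta\leftarrow\gamma)$; $(\alpha\rightarrow\beta)\rightarrow\gamma=(\alpha\leftarrow\beta)\rightarrow\gamma=\alpha\rightarrow(\beta\rightarrow\gamma)$. An extended diassociative semigroup (EDS) is $(\Omega,\leftarrow,\rightarrow,\triangleleft,\triangleright)$ such that $(\Omega,\leftarrow,\rightarrow)$ is a diassociative semigroup and for all $\alpha,\beta,\gamma\in\Omega$: $\alpha\triangleright(\beta\leftarrow\gamma)=\alpha\triangleright\beta$; $(\alpha\rightarrow\beta)\triangleleft\gamma=\beta\triangleleft\gamma$; $(\alpha\triangleleft\beta)\leftarrow((\alpha\leftarrow\beta)\triangleleft\gamma)=\alpha\triangleleft(\beta\leftarrow\gamma)$;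 $(\alpha\triangleleft\beta)\triangleleft((\alpha\leftarrow\beta)\triangleleft\gamma)=\beta\triangleleft\gamma$; $(\alpha\triangleleft\beta)\rightarrow((\alpha\leftarrow\beta)\triangleleft\gamma)=\alpha\triangleleft(\beta\rightarrow\gamma)$; $(\alpha\triangleleft\beta)\triangleright((\alpha\leftarrow\beta)\triangleleft\gamma)=\beta\triangleright\gamma$; $(\alpha\triangleright(\beta\rightarrow\gamma))\leftarrow(\beta\triangleright\gamma)=(\alpha\leftarrow\beta)\triangleright\gamma$; $(\alpha\triangleright(\beta\rightarrow\gamma))\triangleleft(\beta\triangleright\gamma)=\alpha\triangleleft\beta$; $(\alpha\triangleright(\beta\rightarrow\gamma))\rightarrow(\beta\triangleright\gamma)=(\alpha\rightarrow\beta)\triangleright\gamma$; $(\alpha\triangleright(\beta\rightarrow\gamma))\triangleright(\beta\triangleright\gamma)=\alpha\triangleright\beta$. It is commutative if $\alpha\rightarrow\beta=\beta\leftarrow\alpha$ and $\alpha\triangleright\beta=\beta\triangleleft\alpha$ for all $\alpha,\beta$. It is nondegenerate if the maps $(\alpha,\beta)\mapsto(\alpha\leftarrow\beta,\alpha\triangleleft\beta)$ and $(\alpha,\beta)\mapsto(\alpha\rightarrow\beta,\alpha\triangleright\beta)$ from $\Omega^2$ to $\Omega^2$ are bijective. Typed words. $\mathrm{Sh}^+_\Omega(V)=\bigoplus_{n\geq1}(\mathbb{K}\Omega)^{\otimes(n-1)}\otimes V^{\otimes n}$ ($\mathbb{K}\Omega$ has basis $\Omega$), spanned by typed words $\alpha_2\ldots\alpha_n\otimes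 v_1\ldots v_n$. For $\alpha\in\Omega$, $v\in V$, put $(\alpha\otimes v)\cdot(\alpha_2\ldots\alpha_n\otimes v_1\ldots v_n)=\alpha\alpha_2\ldots\alpha_n\otimes vv_1\ldots v_n$. Each typed word of length $\ge2$ is of the form $(\beta\otimes v)\cdot x'$. The bilinear products are defined recursively, for typed words $x,y$ and $v,w\in V$, by: $v\prec_\alpha y=(\alpha\otimes v)\cdot y$; $x\succ_\alpha w=(\alpha\otimes w)\cdot x$; if $x=(\beta\otimes v)\cdot x'$, $x\prec_\alpha y=((\beta\leftarrow\alpha)\otimes v)\cdot(x'\prec_{\beta\triangleleft\alpha}y)+((\beta\rightarrow\alpha)\otimes v)\cdot(x'\succ_{\beta\triangleright\alpha}y)$; if $y=(\beta\otimes w)\cdot y'$, $x\succ_\alpha y=((\alpha\leftarrow\beta)\otimes w)\cdot(x\prec_{\alpha\triangleleft\beta}y')+((\alpha\rightarrow\beta)\otimes w)\cdot(x\succ_{\alpha\triangleright\beta}y')$. The space $\mathbb{K}\Omega\otimes\mathrm{Sh}^+_\Omega(V)$ is a dendriform algebra with $(\alpha\otimes x)\prec(\beta\otimes y)=(\alpha\leftarrow\beta)\otimes(x\prec_{\alpha\triangleleft\beta}y)$ and $(\alpha\otimes x)\succ(\beta\otimes y)=(\alpha\rightarrow\beta)\otimes(x\succ_{\alpha\triangleright\beta}y)$. Dendriform algebra: bilinear $\prec,\succ$ with $(x\prec y)\prec z=x\prec(y\prec z+y\succ z)$, $(x\succ y)\prec z=x\succ(y\prec z)$, $(x\prec y+x\succ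 y)\succ z=x\succ(y\succ z)$. A dendriform bialgebra is $(B,\prec,\succ,\Delta)$ with $(B,\prec,\succ)$ a dendriform algebra, $(B,\Delta)$ a coassociative (not necessarily counital) coalgebra such that, with $\Delta(x)=x'\otimes x''$ (Sweedler) and $\cdot=\prec+\succ$, for all $x,y\in B$: $\Delta(x\prec y)=x\otimes y+x'\prec y\otimes x''+x'\otimes x''\cdot y+x\prec y'\otimes y''+x'\prec y'\otimes x''\cdot y''$ and $\Delta(x\succ y)=y\otimes x+x'\succ y\otimes x''+y'\otimes x\cdot y''+x\succ y'\otimes y''+x'\succ y'\otimes x''\cdot y''$. *)

(* Defs.v *)
(* MathComp, with the axioms of boolp; {freeg X / K} is the free K-module on X. *)
From HB Require Import structures.
From mathcomp Require Import all_boot all_algebra.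
From mathcomp Require Import boolp.
From mathcomp Require Import freeg.

Set Implicit Arguments.
Unset Strict Implicit.
Unset Printing Implicit Defensive.

Import GRing.Theory.
Local Open Scope ring_scope.
Local Open Scope quotient_scope.

Local Notation bilinear f := (bilinear_for *:%R *:%R f).

Declare Scope eds_scope.
Delimit Scope eds_scope with eds.

HB.mixin Record isDiassociative (T : Type) of Choice T := {
  dias_l : T -> T -> T;
  dias_r : T -> T -> T;
  dias_llA : forall a b c,
    dias_l (dias_l a b) c = dias_l a (dias_l b c);
  dias_llrA : forall a b c,
    dias_l a (dias_l b c) = dias_l a (dias_r b c);
  dias_rlA : forall a b c,
    dias_l (dias_r a b) c = dias_r a (dias_l b c);
  dias_rlrA : forall a b c,
    dias_r (dias_r a b) c = dias_r (dias_l a b) c;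
  dias_rrA : forall a b c,
    dias_r (dias_l a b) c = dias_r a (dias_r b c)
}.

#[short(type="diassociativeType")]
HB.structure Definition Diassociative := {T of isDiassociative T & Choice T}.

Local Notation "a ← b" := (dias_l a b)
  (at level 40, left associativity) : eds_scope.
Local Notation "a → b" := (dias_r a b)
  (at level 40, left associativity) : eds_scope.

Local Open Scope eds_scope.

HB.mixin Record isEDS (T : Type) of Diassociative T := {
  eds_tl : T -> T -> T;
  eds_tr : T -> T -> T;
  eds_tr_l : forall a b c : T, eds_tr a (b ← c) = eds_tr a b;
  eds_tl_r : forall a b c : T, eds_tl (a → b) c = eds_tl b c;
  eds_tl_ll : forall a b c : T,
    eds_tl a b ← eds_tl (a ← b) c = eds_tl a (b ← c);
  eds_tl_tl : forall a b c : T,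
    eds_tl (eds_tl a b) (eds_tl (a ← b) c) = eds_tl b c;
  eds_tl_lr : forall a b c : T,
    eds_tl a b → eds_tl (a ← b) c = eds_tl a (b → c);
  eds_tl_tr : forall a b c : T,
    eds_tr (eds_tl a b) (eds_tl (a ← b) c) = eds_tr b c;
  eds_tr_rl : forall a b c : T,
    eds_tr a (b → c) ← eds_tr b c = eds_tr (a ← b) c;
  eds_tr_tl : forall a b c : T,
    eds_tl (eds_tr a (b → c)) (eds_tr b c) = eds_tl a b;
  eds_tr_rr : forall a b c : T,
    eds_tr a (b → c) → eds_tr b c = eds_tr (a → b) c;
  eds_tr_tr : forall a b c : T,
    eds_tr (eds_tr a (b → c)) (eds_tr b c) = eds_tr a b
}.

#[short(type="edsType")]
HB.structure Definition EDS := {T of isEDS T & Diassociative T}.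

Local Notation "a ◁ b" := (eds_tl a b)
  (at level 40, left associativity) : eds_scope.
Local Notation "a ▷ b" := (eds_tr a b)
  (at level 40, left associativity) : eds_scope.

Definition eds_commutative (T : edsType) : Prop :=
  (forall a b : T, a → b = b ← a) /\ (forall a b : T, a ▷ b = b ◁ a).

Definition eds_nondegenerate (T : edsType) : Prop :=
  bijective (fun p : T * T => (p.1 ← p.2, p.1 ◁ p.2)) /\
  bijective (fun p : T * T => (p.1 → p.2, p.1 ▷ p.2)).

Section FreeLift.
Variables (K : fieldType) (X : choiceType) (E : lmodType K).

Lemma fglift_sum (f : X -> E) (z : {freeg X / K}) (r : seq X) :
  uniq r -> {subset dom z <= r} ->
  fglift f z = \sum_(x <- r) coeff x z *: f x.
Proof.
move=> ur sr.
have fl0 : fglift f 0 = 0 by rewrite -freeg_nil fglift_Freeg prelift_nil.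
have flN u : fglift f (- u) = - fglift f u.
  by rewrite -[- u]add0r lift_is_additive fl0 add0r.
have flD u v : fglift f (u + v) = fglift f u + fglift f v.
  by rewrite -[v in LHS]opprK lift_is_additive flN opprK.
rewrite -{1}[z]freeg_sumE (big_morph (fglift f) flD fl0).
under eq_bigr do rewrite liftU.
rewrite [RHS](bigID (mem (dom z))) /= addrC [X in X + _]big1 ?add0r; last first.
  by move=> x xz; rewrite coeff_outdom // scale0r.
rewrite -[RHS]big_filter; apply: perm_big; apply: uniq_perm.
- exact: uniq_dom.
- exact: filter_uniq.
by move=> x; rewrite mem_filter; case xz: (x \in dom z); rewrite //= sr.
Qed.

Lemma fglift_linear (f : X -> E) : linear (fglift f : {freeg X / K} -> E).
Proof.
move=> a u v; set r := undup (dom (a *: u + v) ++ dom u ++ dom v).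
have ur : uniq r by exact: undup_uniq.
rewrite !(@fglift_sum _ _ r) //; try by
  move=> x xd; rewrite mem_undup !mem_cat xd ?orbT.
rewrite scaler_sumr -big_split /=; apply: eq_bigr => x _.
by rewrite coeffD coeffZ scalerDl scalerA.
Qed.

Lemma fglift_U (f : X -> E) (x : X) :
  fglift f (<< x >> : {freeg X / K}) = f x.
Proof. by rewrite liftU scale1r. Qed.

Lemma fglift_lin (a : K) (f g : X -> E) (z : {freeg X / K}) :
  fglift (fun x => a *: f x + g x) z = a *: fglift f z + fglift g z.
Proof.
rewrite !(@fglift_sum _ _ (dom z)) ?uniq_dom // scaler_sumr -big_split /=.
by apply: eq_bigr => x _; rewrite scalerDr !scalerA mulrC.
Qed.

Lemma eq_fglift (f g : X -> E) (z : {freeg X / K}) :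
  f =1 g -> fglift f z = fglift g z.
Proof.
by move=> fg; congr (fglift _ z); exact/funext.
Qed.

Lemma freeg_ext (h1 h2 : {freeg X / K} -> E) : linear h1 -> linear h2 ->
  (forall x, h1 << x >> = h2 << x >>) -> h1 =1 h2.
Proof.
move=> l1 l2 h z; rewrite -[z]freeg_sumE.
have P (h0 : {freeg X / K} -> E) (l : linear h0) :
    h0 (\sum_(x <- dom z) << coeff x z *g x >>) =
    \sum_(x <- dom z) coeff x z *: h0 << x >>.
  have h00 : h0 0 = 0 by move: (l (-1) 0 0); rewrite !scaleN1r !addNr.
  have hD u v : h0 (u + v) = h0 u + h0 v by move: (l 1 u v); rewrite !scale1r.
  rewrite (big_morph h0 hD h00); apply: eq_bigr => x _.
  rewrite -[RHS]addr0 -h00 -l addr0; congr h0.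
  by apply/eqP/freeg_eqP => k; rewrite coeffZ !coeffU mul1r.
by rewrite !P //; apply: eq_bigr => x _; rewrite h.
Qed.

End FreeLift.

Section Tensor.
Variables (K : fieldType) (U W : lmodType K).

Local Notation F := {freeg (U * W)%type / K}.

Inductive tens_rel : F -> Prop :=
| TensRelL a u u' w :
    tens_rel (<< (a *: u + u', w) >> - (a *: << (u, w) >> + << (u', w) >>))
| TensRelR a u w w' :
    tens_rel (<< (u, a *: w + w') >> - (a *: << (u, w) >> + << (u, w') >>)).

(* The least submodule containing the bilinearity relations.                  *)
Definition tens_null : {pred F} := fun z =>
  `[< forall S : {pred F}, GRing.submod_closed S ->
        (forall r, tens_rel r -> r \in S) -> z \in S >].

Lemma tens_nullP z : reflect
  (forall S : {pred F}, GRing.submod_closed S ->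
     (forall r, tens_rel r -> r \in S) -> z \in S)
  (z \in tens_null).
Proof. exact: asboolP. Qed.

Lemma tens_null_submod : GRing.submod_closed tens_null.
Proof.
split=> [|a u v /tens_nullP Hu /tens_nullP Hv];
  apply/tens_nullP => S [S0 SZ] SR //.
by apply: (SZ a u v); [apply: Hu | apply: Hv].
Qed.

HB.instance Definition _ :=
  GRing.isZmodClosed.Build F tens_null (GRing.submod_closedB tens_null_submod).

Definition tensor : Type := {ideal_quot tens_null}.

HB.instance Definition _ := GRing.Zmodule.on tensor.

Definition tens_pi (z : F) : tensor := \pi_({ideal_quot tens_null}) z.

Lemma tens_piK z : tens_pi (repr (z : {ideal_quot tens_null})) = z.
Proof. exact: reprK. Qed.

Lemma tens_piP z t : tens_pi z = tens_pi t <-> z - t \in tens_null.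
Proof. by rewrite Quotient.idealrBE; split=> [/eqP|/eqP]. Qed.

Lemma tens_piD z t : tens_pi (z + t) = tens_pi z + tens_pi t.
Proof. by rewrite /tens_pi !piE. Qed.

Definition tens_scale (a : K) (z : tensor) : tensor :=
  tens_pi (a *: repr (z : {ideal_quot tens_null})).

Lemma tens_scale_pi a z : tens_scale a (tens_pi z) = tens_pi (a *: z).
Proof.
apply/tens_piP; rewrite -scalerBr; have [s0 sZ] := tens_null_submod.
rewrite -[_ *: _]addr0; apply: (sZ a _ 0) => //.
by apply/tens_piP; rewrite tens_piK.
Qed.

Fact tens_scaleA a b z : tens_scale a (tens_scale b z) = tens_scale (a * b) z.
Proof. by rewrite -[z]tens_piK !tens_scale_pi scalerA. Qed.
Fact tens_scale1 : left_id 1 tens_scale.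
Proof. by move=> z; rewrite -[z]tens_piK !tens_scale_pi scale1r. Qed.
Fact tens_scaleDr : right_distributive tens_scale +%R.
Proof.
move=> a z t; rewrite -[z]tens_piK -[t]tens_piK -tens_piD !tens_scale_pi.
by rewrite scalerDr tens_piD.
Qed.
Fact tens_scaleDl z : {morph tens_scale^~ z : a b / a + b}.
Proof. by move=> a b; rewrite -[z]tens_piK !tens_scale_pi scalerDl tens_piD. Qed.

HB.instance Definition _ := GRing.Zmodule_isLmodule.Build K tensor
  tens_scaleA tens_scale1 tens_scaleDr tens_scaleDl.

Definition tens (u : U) (w : W) : tensor := tens_pi << (u, w) >>.

Lemma tens_pi_linear : linear tens_pi.
Proof. by move=> a z t; rewrite tens_piD -tens_scale_pi. Qed.

Lemma tens_null_rel r : tens_rel r -> r \in tens_null.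
Proof. by move=> Rr; apply/tens_nullP => S _; apply. Qed.

Lemma tens_bilinear : bilinear tens.
Proof.
split=> [w a u u' | u a w w'].
  rewrite /tens -(tens_pi_linear a << (u, w) >> << (u', w) >>).
  by apply/tens_piP/tens_null_rel; exact: TensRelL.
rewrite /tens -(tens_pi_linear a << (u, w) >> << (u, w') >>).
by apply/tens_piP/tens_null_rel; exact: TensRelR.
Qed.

Section Lift.
Variable E : lmodType K.

(* If z is a sum of pure tensors z' ⊗ z'' then [tlift f z] is the sum of the  *)
(* f z' z'', for f bilinear; for other f it depends on the choice of repr z.  *)
Definition tlift (f : U -> W -> E) (z : tensor) : E :=
  fglift (fun p => f p.1 p.2) (repr (z : {ideal_quot tens_null})).

Lemma tlift_pi f z : bilinear f ->
  tlift f (tens_pi z) = fglift (fun p => f p.1 p.2) z.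
Proof.
move=> [fl fr]; set g := fun p => _; have gl := @fglift_linear _ _ _ g.
have g0 : fglift g 0 = 0 by rewrite -freeg_nil fglift_Freeg prelift_nil.
have gB x y : fglift g (x - y) = fglift g x - fglift g y.
  by have := gl (-1) y x; rewrite !scaleN1r [- y + x]addrC => ->; rewrite addrC.
pose S : {pred F} := fun x => fglift g x == 0.
have SP : GRing.submod_closed S.
  split=> [|a x y]; rewrite !unfold_in /S ?g0 // gl => /eqP -> /eqP ->.
  by rewrite scaler0 addr0.
have SR r : tens_rel r -> r \in S.
  by case=> *; rewrite unfold_in /S gB gl !fglift_U /g /= ?fl ?fr subrr.
apply/eqP; rewrite -subr_eq0 -gB; apply: (elimT (tens_nullP _) _ S SP SR).
by apply/tens_piP; rewrite tens_piK.
Qed.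

Lemma tlift_tens f u w : bilinear f -> tlift f (tens u w) = f u w.
Proof. by move=> bf; rewrite tlift_pi // fglift_U. Qed.

Lemma tlift_linear f : bilinear f -> linear (tlift f).
Proof.
move=> bf a z t; rewrite -[z]tens_piK -[t]tens_piK.
set x := repr z; set y := repr t.
by rewrite -(tens_pi_linear a x y) !(tlift_pi _ bf) (fglift_linear _ a x y).
Qed.

Lemma tlift_lin a f g z :
  tlift (fun u w => a *: f u w + g u w) z = a *: tlift f z + tlift g z.
Proof. exact: fglift_lin. Qed.

Lemma eq_tlift f g z : f =2 g -> tlift f z = tlift g z.
Proof. by move=> fg; apply: eq_fglift => p; exact: fg. Qed.

Lemma tensor_ext (h1 h2 : tensor -> E) : linear h1 -> linear h2 ->
  (forall u w, h1 (tens u w) = h2 (tens u w)) -> h1 =1 h2.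
Proof.
move=> l1 l2 h z; rewrite -[z]tens_piK.
apply: (@freeg_ext _ _ _ (h1 \o tens_pi) (h2 \o tens_pi)) => [a x y|a x y|[u w]].
- by rewrite /= tens_pi_linear l1.
- by rewrite /= tens_pi_linear l2.
exact: h.
Qed.

End Lift.
End Tensor.

Local Notation "U ⊗ W" := (tensor U W)
  (at level 40, left associativity) : type_scope.
Local Notation "u ⊗ w" := (tens u w)
  (at level 40, left associativity) : ring_scope.

Section DirectSum.
Variables (K : fieldType) (M : nat -> lmodType K).

Record dsum : Type := DSum {
  dsum_val :> forall n, M n;
  dsum_fin : exists N, forall n, (N <= n)%N -> dsum_val n = 0
}.

Lemma dsum_eq (x y : dsum) : (forall n, x n = y n) -> x = y.
Proof.
case: x y => [x px] [y py] /= xy.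
have {}xy : x = y by exact: functional_extensionality_dep.
by case: y / xy py => py; congr DSum; exact: Prop_irrelevance.
Qed.

HB.instance Definition _ := gen_eqMixin dsum.
HB.instance Definition _ := gen_choiceMixin dsum.

Fact dsum_zero_fin : exists N, forall n, (N <= n)%N -> (0 : M n) = 0.
Proof. by exists 0%N. Qed.
Definition dsum_zero := DSum dsum_zero_fin.

Fact dsum_opp_fin (x : dsum) :
  exists N, forall n, (N <= n)%N -> - x n = 0.
Proof. by have [N xN] := dsum_fin x; exists N => n /xN ->; rewrite oppr0. Qed.
Definition dsum_opp x := DSum (dsum_opp_fin x).

Fact dsum_add_fin (x y : dsum) :
  exists N, forall n, (N <= n)%N -> x n + y n = 0.
Proof.
have [[N xN] [P yP]] := (dsum_fin x, dsum_fin y); exists (maxn N P) => n.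
by rewrite geq_max => /andP[/xN -> /yP ->]; rewrite addr0.
Qed.
Definition dsum_add x y := DSum (dsum_add_fin x y).

Fact dsum_scale_fin a (x : dsum) :
  exists N, forall n, (N <= n)%N -> a *: x n = 0.
Proof. by have [N xN] := dsum_fin x; exists N => n /xN ->; rewrite scaler0. Qed.
Definition dsum_scale a x := DSum (dsum_scale_fin a x).

Fact dsum_addA : associative dsum_add.
Proof. by move=> x y z; apply: dsum_eq => n; apply: addrA. Qed.
Fact dsum_addC : commutative dsum_add.
Proof. by move=> x y; apply: dsum_eq => n; apply: addrC. Qed.
Fact dsum_add0 : left_id dsum_zero dsum_add.
Proof. by move=> x; apply: dsum_eq => n; apply: add0r. Qed.
Fact dsum_addN : left_inverse dsum_zero dsum_opp dsum_add.
Proof. by move=> x; apply: dsum_eq => n; apply: addNr. Qed.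

HB.instance Definition _ :=
  GRing.isZmodule.Build dsum dsum_addA dsum_addC dsum_add0 dsum_addN.

Fact dsum_scaleA a b x : dsum_scale a (dsum_scale b x) = dsum_scale (a * b) x.
Proof. by apply: dsum_eq => n; apply: scalerA. Qed.
Fact dsum_scale1 : left_id 1 dsum_scale.
Proof. by move=> x; apply: dsum_eq => n; apply: scale1r. Qed.
Fact dsum_scaleDr : right_distributive dsum_scale +%R.
Proof. by move=> a x y; apply: dsum_eq => n; apply: scalerDr. Qed.
Fact dsum_scaleDl x : {morph dsum_scale^~ x : a b / a + b}.
Proof. by move=> a b; apply: dsum_eq => n; apply: scalerDl. Qed.

HB.instance Definition _ := GRing.Zmodule_isLmodule.Build K dsum
  dsum_scaleA dsum_scale1 dsum_scaleDr dsum_scaleDl.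

Lemma dsumE a (x y : dsum) n : (a *: x + y) n = a *: x n + y n.
Proof. by []. Qed.

Fact dsum_in_fin n (m : M n) :
  exists N, forall k, (N <= k)%N -> dfwith (fun k => 0 : M k) m k = 0.
Proof. by exists n.+1 => k nk; rewrite dfwith_out // neq_ltn nk. Qed.
Definition dsum_in n (m : M n) : dsum := DSum (dsum_in_fin m).

Lemma dsum_in_linear n : linear (@dsum_in n).
Proof.
move=> a x y; apply: dsum_eq => k; rewrite dsumE /=.
have [-> | nk] := eqVneq k n; first by rewrite !dfwith_in.
by rewrite !dfwith_out 1?eq_sym // scaler0 addr0.
Qed.

Definition dsum_bound (x : dsum) : nat := sval (cid (dsum_fin x)).

Section Lift.
Variable E : lmodType K.

Definition dsum_lift (f : forall n, M n -> E) (x : dsum) : E :=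
  \sum_(n < dsum_bound x) f n (x n).

Section LiftTheory.
Variable f : forall n, M n -> E.
Hypothesis fl : forall n, linear (@f n).

Local Lemma lift0 n : f (0 : M n) = 0.
Proof. by move: (fl (-1) (0 : M n) 0); rewrite !scaleN1r !addNr. Qed.

Lemma dsum_lift_wide (x : dsum) N : (forall n, (N <= n)%N -> x n = 0) ->
  dsum_lift f x = \sum_(n < N) f (x n).
Proof.
move=> xN; rewrite /dsum_lift /dsum_bound; case: cid => P xP /=.
pose G n := f (x n).
have W Q R : (Q <= R)%N -> (forall n, (Q <= n)%N -> x n = 0) ->
    \sum_(n < Q) G n = \sum_(n < R) G n.
  move=> QR xQ; rewrite (big_ord_widen R G QR).
  rewrite [RHS](bigID (fun n : 'I_R => (n < Q)%N)) /=.
  rewrite [X in _ = _ + X]big1 ?addr0 // => n; rewrite -leqNgt => /xQ.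
  by rewrite /G => ->; rewrite lift0.
rewrite -[LHS]/(\sum_(n < P) G n) -[RHS]/(\sum_(n < N) G n).
by rewrite (W P _ (leq_maxl P N) xP) (W N _ (leq_maxr P N) xN).
Qed.

Lemma dsum_lift_linear : linear (dsum_lift f).
Proof.
move=> a x y; have [[N xN] [P yP]] := (dsum_fin x, dsum_fin y).
pose Q := maxn N P.
have xQ n : (Q <= n)%N -> x n = 0 by rewrite geq_max => /andP[/xN].
have yQ n : (Q <= n)%N -> y n = 0 by rewrite geq_max => /andP[_ /yP].
have zQ n : (Q <= n)%N -> (a *: x + y) n = 0.
  by move=> Qn; rewrite -[LHS]/(a *: x n + y n) xQ // yQ // scaler0 addr0.
rewrite !(@dsum_lift_wide _ Q) // scaler_sumr -big_split /=.
by apply: eq_bigr => n _; exact: fl.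
Qed.

Lemma dsum_lift_in n (m : M n) : dsum_lift f (dsum_in m) = f m.
Proof.
rewrite (@dsum_lift_wide _ n.+1) => [|k nk]; last first.
  by rewrite /= dfwith_out // neq_ltn nk.
rewrite big_ord_recr /= dfwith_in big1 ?add0r // => k _.
by rewrite dfwith_out ?lift0 // eq_sym neq_ltn ltn_ord.
Qed.

End LiftTheory.

Lemma eq_dsum_lift (f g : forall n, M n -> E) x :
  (forall n m, f n m = g n m) -> dsum_lift f x = dsum_lift g x.
Proof. by move=> fg; apply: eq_bigr => n _; exact: fg. Qed.

Lemma dsum_lift_lin a (f g : forall n, M n -> E) x :
  dsum_lift (fun n m => a *: f n m + g n m) x =
  a *: dsum_lift f x + dsum_lift g x.
Proof. by rewrite /dsum_lift scaler_sumr -big_split. Qed.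

Lemma dsum_ext (h1 h2 : dsum -> E) : linear h1 -> linear h2 ->
  (forall n (m : M n), h1 (dsum_in m) = h2 (dsum_in m)) -> h1 =1 h2.
Proof.
move=> l1 l2 h x; have [N xN] := dsum_fin x.
have -> : x = \sum_(n < N) dsum_in (x n).
  apply: dsum_eq => k.
  pose ev (y : dsum) := y k.
  rewrite -[RHS]/(ev _) (big_morph ev (id1 := 0) (op1 := +%R)) //.
  have [kN | Nk] := ltnP k N.
    rewrite (bigD1 (Ordinal kN)) //= /ev dfwith_in big1 ?addr0 // => n nk.
    by rewrite /= dfwith_out.
  rewrite xN // big1 // => n _; rewrite /ev /= dfwith_out //.
  by rewrite neq_ltn (leq_trans (ltn_ord n)).
have P (h0 : dsum -> E) (l : linear h0) :
    h0 (\sum_(n < N) dsum_in (x n)) = \sum_(n < N) h0 (dsum_in (x n)).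
  have h00 : h0 0 = 0 by move: (l (-1) 0 0); rewrite !scaleN1r !addNr.
  have hD u v : h0 (u + v) = h0 u + h0 v by move: (l 1 u v); rewrite !scale1r.
  exact: (big_morph h0 hD h00).
by rewrite !P //; apply: eq_bigr.
Qed.

End Lift.
End DirectSum.

Section TensorPower.
Variables (K : fieldType) (U : lmodType K).

(* U^{⊗n}, associated to the right and ending with the factor K.              *)
Fixpoint tpow (n : nat) : lmodType K :=
  if n is n'.+1 then (U ⊗ tpow n')%type else K^o.

End TensorPower.

Section TypedWords.
Variables (K : fieldType) (Omega : choiceType) (V : lmodType K).

Local Notation KO := {freeg Omega / K}.

(* [tlet v] is the word v of length 1, and [tcons a v x] is (a ⊗ v) · x: the  *)
(* type a stands between the letter v and the first letter of x.              *)
Inductive tword : Type :=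
| tlet of V
| tcons of Omega & V & tword.

(* The number of types of a word, which is one less than its length.          *)
Fixpoint ntypes (x : tword) : nat :=
  if x is tcons _ _ x' then (ntypes x').+1 else 0.

Fixpoint types (x : tword) : tpow KO (ntypes x) :=
  match x with
  | tlet _ => 1
  | tcons a _ x' => << a >> ⊗ types x'
  end.

Fixpoint letters (x : tword) : tpow V (ntypes x).+1 :=
  match x with
  | tlet v => v ⊗ 1
  | tcons _ v x' => v ⊗ letters x'
  end.

(* The words of length n.+1.                                                  *)
Definition Sh_part (n : nat) : lmodType K := (tpow KO n ⊗ tpow V n.+1)%type.

Definition Sh : lmodType K := dsum Sh_part.

Definition word (x : tword) : Sh :=
  @dsum_in K Sh_part (ntypes x) (types x ⊗ letters x).

(* [wlin a x x1 x2]: the words x, x1 and x2 agree but for one letter, which is *)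
(* a *: u + u' in x, u in x1 and u' in x2.                                    *)
Inductive wlin (a : K) : tword -> tword -> tword -> Prop :=
| WlinLet u u' : wlin a (tlet (a *: u + u')) (tlet u) (tlet u')
| WlinHead b u u' x :
    wlin a (tcons b (a *: u + u') x) (tcons b u x) (tcons b u' x)
| WlinTail b v x x1 x2 :
    wlin a x x1 x2 -> wlin a (tcons b v x) (tcons b v x1) (tcons b v x2).

Definition multilinear (E : lmodType K) (g : tword -> E) : Prop :=
  forall a x x1 x2, wlin a x x1 x2 -> g x = a *: g x1 + g x2.

Section Lift.
Variable E : lmodType K.
Implicit Types (g : tword -> E).

Fixpoint part_lift n g : tpow KO n -> tpow V n.+1 -> E :=
  match n with
  | 0 => fun c => tlift (fun v d => (c * d) *: g (tlet v))
  | n'.+1 => fun A B => tlift (fun al A' => tlift (fun v B' =>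
      fglift (fun a => part_lift (fun x => g (tcons a v x)) A' B') al) B) A
  end.

(* For g multilinear, the linear map with values g x on the words x; see       *)
(* Sh_lift_linear, Sh_lift_word and Sh_ext.                                   *)
Definition Sh_lift g : Sh -> E :=
  dsum_lift (fun n => tlift (@part_lift n g)).

Lemma part_lift_lin n a g1 g2 A B :
  part_lift (n := n) (fun x => a *: g1 x + g2 x) A B =
  a *: part_lift g1 A B + part_lift g2 A B.
Proof.
elim: n g1 g2 A B => [|n IH] g1 g2 A B /=; rewrite -tlift_lin; apply: eq_tlift.
  by move=> v d; rewrite scalerDr !scalerA [_ * a]mulrC.
move=> al A'; rewrite -tlift_lin; apply: eq_tlift => v B'.
by rewrite -fglift_lin; apply: eq_fglift => b; rewrite IH.
Qed.

Lemma eq_part_lift n g1 g2 A B : g1 =1 g2 ->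
  part_lift (n := n) g1 A B = part_lift g2 A B.
Proof. by move=> /funext ->. Qed.

Lemma multilinear_tcons g b v : multilinear g ->
  multilinear (fun x => g (tcons b v x)).
Proof. by move=> gm a x x1 x2 w; apply: gm; constructor. Qed.

Lemma part_lift_inner n g (b : KO) (A : tpow KO n) : multilinear g ->
  (forall g', multilinear g' -> bilinear (part_lift (n := n) g')) ->
  bilinear (fun v B' =>
    fglift (fun a => part_lift (n := n) (fun x => g (tcons a v x)) A B') b).
Proof.
move=> gm IH; split=> [B' c v v' | v c B1 B2]; rewrite -fglift_lin;
  apply: eq_fglift => a.
  rewrite -part_lift_lin; apply: eq_part_lift => x.
  by apply: gm; constructor.
by rewrite ((IH _ (multilinear_tcons _ _ gm)).2 A c B1 B2).
Qed.

Lemma part_lift_bilinear n g : multilinear g -> bilinear (part_lift (n := n) g).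
Proof.
elim: n g => [|n IH] g gm.
  have gb c : bilinear (fun v (d : K^o) => (c * d) *: g (tlet v)).
    split=> [d a u u' | v a d d'] /=.
      rewrite (gm a _ (tlet u) (tlet u')); last by constructor.
      by rewrite scalerDr !scalerA [_ * a]mulrC.
    by rewrite scalerA -scalerDl mulrDr -[a *: d]/(a * d) mulrCA.
  split=> [B a c c' | c a B B'] /=.
    rewrite -tlift_lin; apply: eq_tlift => v d.
    by rewrite scalerA -scalerDl -[a *: c]/(a * c) mulrDl mulrA.
  exact: (tlift_linear (gb c)).
have inb al A : bilinear (fun v B' =>
    fglift (fun a => part_lift (n := n) (fun x => g (tcons a v x)) A B') al).
  exact: part_lift_inner.
have outb B : bilinear (fun al A' => tlift (fun v B' => fglift (fun a =>
    part_lift (n := n) (fun x => g (tcons a v x)) A' B') al) B).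
  split=> [A' c al al' | al c A1 A2]; rewrite -tlift_lin;
    apply: eq_tlift => v B'.
    exact: fglift_linear.
  rewrite -fglift_lin; apply: eq_fglift => a.
  by rewrite ((IH _ (multilinear_tcons _ _ gm)).1 B' c A1 A2).
split=> [B a A A' | A a B B'] /=; first exact: (tlift_linear (outb B)).
rewrite -tlift_lin; apply: eq_tlift => al A'.
exact: (tlift_linear (inb al A')).
Qed.

Lemma part_lift_word g x : multilinear g ->
  part_lift g (types x) (letters x) = g x.
Proof.
elim: x g => [v | b v x IH] g gm /=.
  rewrite tlift_tens ?mulr1 ?scale1r //.
  split=> [d a u u' | u a d d'] /=; rewrite !mul1r.
    rewrite (gm a _ (tlet u) (tlet u')); last by constructor.
    by rewrite scalerDr !scalerA [_ * a]mulrC.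
  by rewrite scalerDl scalerA.
have inb al A : bilinear (fun v B' => fglift (fun a =>
    part_lift (n := ntypes x) (fun x => g (tcons a v x)) A B') al).
  by apply: part_lift_inner => // g' g'm; exact: part_lift_bilinear.
rewrite tlift_tens.
  rewrite (tlift_tens _ _ (inb _ _)) fglift_U.
  exact: (IH _ (multilinear_tcons _ _ gm)).
split=> [A' c al al' | al c A1 A2]; rewrite -tlift_lin;
  apply: eq_tlift => w B'; first exact: fglift_linear.
rewrite -fglift_lin; apply: eq_fglift => a.
by rewrite ((part_lift_bilinear (ntypes x) (multilinear_tcons _ _ gm)).1 B' c A1 A2).
Qed.

Lemma Sh_lift_linear g : multilinear g -> linear (Sh_lift g).
Proof.
move=> gm; apply: dsum_lift_linear => n.
exact: tlift_linear (part_lift_bilinear _ gm).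
Qed.

Lemma Sh_lift_word g x : multilinear g -> Sh_lift g (word x) = g x.
Proof.
move=> gm; rewrite /Sh_lift /word dsum_lift_in => [|n]; last first.
  exact: tlift_linear (part_lift_bilinear _ gm).
by rewrite (tlift_tens _ _ (part_lift_bilinear _ gm)) part_lift_word.
Qed.

Lemma Sh_lift_lin a g1 g2 z :
  Sh_lift (fun x => a *: g1 x + g2 x) z = a *: Sh_lift g1 z + Sh_lift g2 z.
Proof.
rewrite -dsum_lift_lin; apply: eq_dsum_lift => n m.
by rewrite -tlift_lin; apply: eq_tlift => A B; apply: part_lift_lin.
Qed.

Lemma eq_Sh_lift g1 g2 z : g1 =1 g2 -> Sh_lift g1 z = Sh_lift g2 z.
Proof. by move=> /funext ->. Qed.

Lemma part_ext (h1 h2 : forall n, tpow KO n -> tpow V n.+1 -> E) n A B :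
  (forall m, bilinear (h1 m)) -> (forall m, bilinear (h2 m)) ->
  (forall x, h1 _ (types x) (letters x) = h2 _ (types x) (letters x)) ->
  h1 n A B = h2 n A B.
Proof.
elim: n h1 h2 A B => [|n IH] h1 h2 A B b1 b2 h.
  apply: (@tensor_ext _ _ _ _ (h1 0%N A) (h2 0%N A)).
  - exact: (b1 0%N).2.
  - exact: (b2 0%N).2.
  move=> v d.
  have Ad (h0 : forall n, tpow KO n -> tpow V n.+1 -> E) :
      (forall m, bilinear (h0 m)) ->
      h0 0%N A (v ⊗ d) = (A * d) *: h0 0%N (1 : K^o) (v ⊗ (1 : K^o)).
    move=> b0; have lin0 (G H : lmodType K) (k : G -> H) : linear k -> k 0 = 0.
      by move=> l; move: (l (-1) 0 0); rewrite !scaleN1r !addNr.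
    have linZ (G H : lmodType K) (k : G -> H) a x :
        linear k -> k (a *: x) = a *: k x.
      by move=> l; rewrite -[a *: x]addr0 l lin0 // addr0.
    rewrite -[X in h0 0%N X]mulr1 -[X in _ ⊗ X]mulr1.
    rewrite -[A * 1]/(A *: (1 : K^o)) -[d * 1]/(d *: (1 : K^o)).
    rewrite (linZ _ _ _ _ _ ((tens_bilinear _ _).2 v)).
    rewrite (linZ _ _ _ _ _ ((b0 0%N).2 _)) (linZ _ _ _ _ _ ((b0 0%N).1 _)).
    by rewrite scalerA mulrC.
  by rewrite !Ad // (h (tlet v)).
apply: (@tensor_ext _ _ _ _ (h1 n.+1 ^~ B) (h2 n.+1 ^~ B)).
- exact: (b1 n.+1).1.
- exact: (b2 n.+1).1.
move=> al A'.
apply: (@tensor_ext _ _ _ _ (h1 n.+1 (al ⊗ A')) (h2 n.+1 (al ⊗ A'))).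
- exact: (b1 n.+1).2.
- exact: (b2 n.+1).2.
move=> v B'.
apply: (@freeg_ext _ _ _ (fun al => h1 n.+1 (al ⊗ A') (v ⊗ B'))
                         (fun al => h2 n.+1 (al ⊗ A') (v ⊗ B'))).
- by move=> c x y; rewrite ((tens_bilinear _ _).1 A' c x y) (b1 n.+1).1.
- by move=> c x y; rewrite ((tens_bilinear _ _).1 A' c x y) (b2 n.+1).1.
move=> a.
pose k (h0 : forall n, tpow KO n -> tpow V n.+1 -> E) m
  (P : tpow KO m) (Q : tpow V m.+1) := h0 m.+1 (<< a >> ⊗ P) (v ⊗ Q).
have kb h0 : (forall m, bilinear (h0 m)) -> forall m, bilinear (k h0 m).
  move=> b0 m; split=> [Q c P P' | P c Q Q'] /=; rewrite /k.
    by rewrite ((tens_bilinear _ _).2 << a >> c P P') (b0 m.+1).1.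
  by rewrite ((tens_bilinear _ _).2 v c Q Q') (b0 m.+1).2.
apply: (IH (k h1) (k h2)); [exact: kb | exact: kb | move=> x].
exact: (h (tcons a v x)).
Qed.

Lemma Sh_ext (h1 h2 : Sh -> E) : linear h1 -> linear h2 ->
  (forall x, h1 (word x) = h2 (word x)) -> h1 =1 h2.
Proof.
move=> l1 l2 h; apply: dsum_ext => // n.
have il m : linear (@dsum_in K Sh_part m) by exact: dsum_in_linear.
apply: tensor_ext => [a x y|a x y|A B]; rewrite ?il ?l1 ?l2 //.
pose k (h0 : Sh -> E) m (A : tpow KO m) (B : tpow V m.+1) : E :=
  h0 (@dsum_in K Sh_part m (A ⊗ B)).
have kb h0 : linear h0 -> forall m, bilinear (k h0 m).
  move=> l0 m; split=> [Q c P P' | P c Q Q'] /=; rewrite /k.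
    by rewrite ((tens_bilinear _ _).1 Q c P P') il l0.
  by rewrite ((tens_bilinear _ _).2 P c Q Q') il l0.
exact: (@part_ext (k h1) (k h2) n A B (kb _ l1) (kb _ l2) h).
Qed.

End Lift.

Lemma word_multilinear : multilinear word.
Proof.
move=> a x x1 x2 xl.
have main (k : forall n, tpow KO n -> tpow V n.+1 -> Sh) :
    (forall m, bilinear (k m)) ->
    k _ (types x) (letters x) =
    a *: k _ (types x1) (letters x1) + k _ (types x2) (letters x2).
  elim: {x x1 x2} xl k => [u u' | b u u' x | b v x x1 x2 _ IH] k kb /=.
  - rewrite ((tens_bilinear _ _).1 (1 : K^o) a u u').
    exact: (kb 0%N).2.
  - rewrite ((tens_bilinear _ _).1 (letters x) a u u').
    exact: (kb (ntypes x).+1).2.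
  apply: (IH (fun m P Q => k m.+1 (<< b >> ⊗ P) (v ⊗ Q))) => m.
  split=> [Q c P P' | P c Q Q'] /=.
    by rewrite ((tens_bilinear _ _).2 << b >> c P P') (kb m.+1).1.
  by rewrite ((tens_bilinear _ _).2 v c Q Q') (kb m.+1).2.
apply: (main (fun m A B => @dsum_in K Sh_part m (A ⊗ B))) => m.
have il : linear (@dsum_in K Sh_part m) by exact: dsum_in_linear.
split=> [Q c P P' | P c Q Q'] /=.
  by rewrite ((tens_bilinear _ _).1 Q c P P') il.
by rewrite ((tens_bilinear _ _).2 P c Q Q') il.
Qed.

Definition Sh_cons (a : Omega) (v : V) : Sh -> Sh :=
  Sh_lift (fun x => word (tcons a v x)).

Lemma Sh_cons_linear a v : linear (Sh_cons a v).
Proof.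
by apply: Sh_lift_linear; apply: multilinear_tcons; exact: word_multilinear.
Qed.

Lemma Sh_cons_word a v x : Sh_cons a v (word x) = word (tcons a v x).
Proof.
rewrite /Sh_cons Sh_lift_word //.
by apply: multilinear_tcons; exact: word_multilinear.
Qed.

Lemma Sh_cons_lin a c v v' z :
  Sh_cons a (c *: v + v') z = c *: Sh_cons a v z + Sh_cons a v' z.
Proof.
rewrite -Sh_lift_lin; apply: eq_Sh_lift => x.
by apply: word_multilinear; constructor.
Qed.

End TypedWords.

Section TypedProducts.
Variables (K : fieldType) (Omega : edsType) (V : lmodType K).

Local Notation KO := {freeg Omega / K}.
Local Notation tword := (tword Omega V).
Local Notation Sh := (Sh Omega V).

(* The pair of the families a |-> x ≺_a y and a |-> x ≻_a y.                  *)
Fixpoint word_prods (x : tword) : tword -> (Omega -> Sh) * (Omega -> Sh) :=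
  fix prods_x (y : tword) : (Omega -> Sh) * (Omega -> Sh) :=
    (fun a => match x with
     | tlet v => word (tcons a v y)
     | tcons b v x' =>
         Sh_cons (b ← a) v ((word_prods x' y).1 (b ◁ a)) +
         Sh_cons (b → a) v ((word_prods x' y).2 (b ▷ a))
     end,
     fun a => match y with
     | tlet w => word (tcons a w x)
     | tcons b w y' =>
         Sh_cons (a ← b) w ((prods_x y').1 (a ◁ b)) +
         Sh_cons (a → b) w ((prods_x y').2 (a ▷ b))
     end).

Definition Sh_prec (a : Omega) (z t : Sh) : Sh :=
  Sh_lift (fun x => Sh_lift (fun y => (word_prods x y).1 a) t) z.

Definition Sh_succ (a : Omega) (z t : Sh) : Sh :=
  Sh_lift (fun x => Sh_lift (fun y => (word_prods x y).2 a) t) z.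

Local Notation "z ≺_( a ) t" := (Sh_prec a z t) (at level 40).
Local Notation "z ≻_( a ) t" := (Sh_succ a z t) (at level 40).

Lemma word_precE x y a : (word_prods x y).1 a =
  match x with
  | tlet v => word (tcons a v y)
  | tcons b v x' =>
      Sh_cons (b ← a) v ((word_prods x' y).1 (b ◁ a)) +
      Sh_cons (b → a) v ((word_prods x' y).2 (b ▷ a))
  end.
Proof. by case: x; case: y. Qed.

Lemma word_succE x y a : (word_prods x y).2 a =
  match y with
  | tlet w => word (tcons a w x)
  | tcons b w y' =>
      Sh_cons (a ← b) w ((word_prods x y').1 (a ◁ b)) +
      Sh_cons (a → b) w ((word_prods x y').2 (a ▷ b))
  end.
Proof. by case: x; case: y. Qed.

Let combine (E : lmodType K) c (p1 p2 q1 q2 : E) :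
  (c *: p1 + p2) + (c *: q1 + q2) = c *: (p1 + q1) + (p2 + q2).
Proof. by rewrite scalerDr addrACA. Qed.

Lemma word_prods_wlin_l c x x1 x2 : wlin c x x1 x2 -> forall y a,
  (word_prods x y).1 a =
    c *: (word_prods x1 y).1 a + (word_prods x2 y).1 a /\
  (word_prods x y).2 a =
    c *: (word_prods x1 y).2 a + (word_prods x2 y).2 a.
Proof.
move=> xl.
suff precP y a : (word_prods x y).1 a =
    c *: (word_prods x1 y).1 a + (word_prods x2 y).1 a.
  elim=> [w | b w y IH] a; split; rewrite ?precP //.
    by rewrite !word_succE; apply: word_multilinear; constructor.
  rewrite !(word_succE _ (tcons b w y)) (IH (a ◁ b)).1 (IH (a ▷ b)).2.
  by rewrite !Sh_cons_linear combine.
elim: {x x1 x2} xl y a => [u u' | b u u' x | b v x x1 x2 xl IH] y a.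
- by rewrite !word_precE; apply: word_multilinear; constructor.
- rewrite (word_precE (tcons _ _ _)) (word_precE (tcons _ u _)).
  by rewrite (word_precE (tcons _ u' _)) !Sh_cons_lin combine.
have succP : (word_prods x y).2 (b ▷ a) =
    c *: (word_prods x1 y).2 (b ▷ a) + (word_prods x2 y).2 (b ▷ a).
  elim: y (b ▷ a) => [w | d w y IHy] {}a.
    by rewrite !word_succE; apply: word_multilinear; constructor.
  by rewrite !(word_succE _ (tcons d w y)) IH IHy !Sh_cons_linear combine.
by rewrite !(word_precE (tcons b v _)) IH succP !Sh_cons_linear combine.
Qed.

Lemma word_prods_wlin_r c y y1 y2 : wlin c y y1 y2 -> forall x a,
  (word_prods x y).1 a =
    c *: (word_prods x y1).1 a + (word_prods x y2).1 a /\
  (word_prods x y).2 a =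
    c *: (word_prods x y1).2 a + (word_prods x y2).2 a.
Proof.
move=> yl.
suff succP x a : (word_prods x y).2 a =
    c *: (word_prods x y1).2 a + (word_prods x y2).2 a.
  elim=> [w | b w x IH] a; split; rewrite ?succP //.
    by rewrite !word_precE; apply: word_multilinear; constructor.
  rewrite !(word_precE (tcons b w x)) (IH (b ◁ a)).1 (IH (b ▷ a)).2.
  by rewrite !Sh_cons_linear combine.
elim: {y y1 y2} yl x a => [u u' | b u u' y | b v y y1 y2 yl IH] x a.
- by rewrite !word_succE; apply: word_multilinear; constructor.
- rewrite (word_succE _ (tcons _ _ _)) (word_succE _ (tcons _ u _)).
  by rewrite (word_succE _ (tcons _ u' _)) !Sh_cons_lin combine.
have precP : (word_prods x y).1 (a ◁ b) =
    c *: (word_prods x y1).1 (a ◁ b) + (word_prods x y2).1 (a ◁ b).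
  elim: x (a ◁ b) => [w | d w x IHx] {}a.
    by rewrite !word_precE; apply: word_multilinear; constructor.
  by rewrite !(word_precE (tcons d w x)) IH IHx !Sh_cons_linear combine.
by rewrite !(word_succE _ (tcons b v _)) IH precP !Sh_cons_linear combine.
Qed.

Section Extension.
Variable f : tword -> tword -> Sh.
Hypothesis fl : forall y, multilinear (f^~ y).
Hypothesis fr : forall x, multilinear (f x).

Let ext (z t : Sh) : Sh := Sh_lift (fun x => Sh_lift (f x) t) z.

Local Lemma ext_inner t : multilinear (fun x => Sh_lift (f x) t).
Proof.
move=> c x x1 x2 xl; rewrite -Sh_lift_lin; apply: eq_Sh_lift => y.
exact: fl.
Qed.

Local Lemma ext_bilinear : bilinear ext.
Proof.
split=> [t c z z' | z c t t'].
  exact: (Sh_lift_linear (ext_inner t)).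
rewrite /ext -Sh_lift_lin; apply: eq_Sh_lift => x.
exact: (Sh_lift_linear (fr x)).
Qed.

Local Lemma ext_word x y : ext (word x) (word y) = f x y.
Proof. by rewrite /ext Sh_lift_word ?Sh_lift_word //; exact: ext_inner. Qed.

End Extension.

Lemma Sh_prec_bilinear a : bilinear (Sh_prec a).
Proof.
by apply: ext_bilinear => [y | x] c z z1 z2 zl;
  [have [] := word_prods_wlin_l zl y a | have [] := word_prods_wlin_r zl x a].
Qed.

Lemma Sh_succ_bilinear a : bilinear (Sh_succ a).
Proof.
by apply: ext_bilinear => [y | x] c z z1 z2 zl;
  [have [] := word_prods_wlin_l zl y a | have [] := word_prods_wlin_r zl x a].
Qed.

Lemma Sh_prec_words a x y : word x ≺_(a) word y = (word_prods x y).1 a.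
Proof.
by apply: (ext_word (f := fun x y => (word_prods x y).1 a)) => z c t t1 t2 tl;
  [have [] := word_prods_wlin_l tl z a | have [] := word_prods_wlin_r tl z a].
Qed.

Lemma Sh_succ_words a x y : word x ≻_(a) word y = (word_prods x y).2 a.
Proof.
by apply: (ext_word (f := fun x y => (word_prods x y).2 a)) => z c t t1 t2 tl;
  [have [] := word_prods_wlin_l tl z a | have [] := word_prods_wlin_r tl z a].
Qed.

(* With bilinearity, these four equations determine both products, by Sh_ext. *)
Lemma Sh_prec_let a v y : word (tlet _ v) ≺_(a) word y = Sh_cons a v (word y).
Proof. by rewrite Sh_prec_words word_precE Sh_cons_word. Qed.

Lemma Sh_succ_let a x w : word x ≻_(a) word (tlet _ w) = Sh_cons a w (word x).
Proof. by rewrite Sh_succ_words word_succE Sh_cons_word. Qed.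

Lemma Sh_prec_cons a b v x y :
  word (tcons b v x) ≺_(a) word y =
  Sh_cons (b ← a) v (word x ≺_(b ◁ a) word y) +
  Sh_cons (b → a) v (word x ≻_(b ▷ a) word y).
Proof. by rewrite !(Sh_prec_words, Sh_succ_words) word_precE. Qed.

Lemma Sh_succ_cons a b w x y :
  word x ≻_(a) word (tcons b w y) =
  Sh_cons (a ← b) w (word x ≺_(a ◁ b) word y) +
  Sh_cons (a → b) w (word x ≻_(a ▷ b) word y).
Proof. by rewrite !(Sh_prec_words, Sh_succ_words) word_succE. Qed.

(* KΩ ⊗ Sh, with basis elements a of Ω written << a >>. The products are given *)
(* on generators by KSh_prec_tens and KSh_succ_tens.                          *)
Definition KSh : lmodType K := (KO ⊗ Sh)%type.

Definition KSh_op (opl : Omega -> Omega -> Omega)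
    (f : Omega -> Omega -> Sh -> Sh -> Sh) (p q : KSh) : KSh :=
  tlift (fun al x => tlift (fun be y =>
    fglift (fun a => fglift (fun b => << opl a b >> ⊗ f a b x y) be) al) q) p.

Definition KSh_prec : KSh -> KSh -> KSh :=
  KSh_op (fun a b => a ← b) (fun a b => Sh_prec (a ◁ b)).

Definition KSh_succ : KSh -> KSh -> KSh :=
  KSh_op (fun a b => a → b) (fun a b => Sh_succ (a ▷ b)).

Section KShOp.
Variables (opl : Omega -> Omega -> Omega).
Variable (f : Omega -> Omega -> Sh -> Sh -> Sh).
Hypothesis fb : forall a b, bilinear (f a b).

Let k al be x y : KSh :=
  fglift (fun a => fglift (fun b => << opl a b >> ⊗ f a b x y) be) al.

Local Lemma k_lin_r al x : bilinear (fun be y => k al be x y).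
Proof.
split=> [y c be be' | be c y y']; rewrite /k -fglift_lin;
  apply: eq_fglift => a; first exact: fglift_linear.
rewrite -fglift_lin; apply: eq_fglift => b.
by rewrite (fb a b).2 (tens_bilinear _ _).2.
Qed.

Local Lemma k_lin_l q : bilinear (fun al x => tlift (fun be y => k al be x y) q).
Proof.
split=> [x c al al' | al c x x']; rewrite -tlift_lin;
  apply: eq_tlift => be y; first exact: fglift_linear.
rewrite /k -fglift_lin; apply: eq_fglift => a.
rewrite -fglift_lin; apply: eq_fglift => b.
by rewrite (fb a b).1 (tens_bilinear _ _).2.
Qed.

Local Lemma KSh_op_bilinear : bilinear (KSh_op opl f).
Proof.
split=> [q c p p' | p c q q']; first exact: (tlift_linear (k_lin_l q)).
rewrite /KSh_op -tlift_lin; apply: eq_tlift => al x.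
exact: (tlift_linear (k_lin_r al x)).
Qed.

Local Lemma KSh_op_tens a b x y :
  KSh_op opl f (<< a >> ⊗ x) (<< b >> ⊗ y) = << opl a b >> ⊗ f a b x y.
Proof.
by rewrite /KSh_op (tlift_tens _ _ (k_lin_l _)) (tlift_tens _ _ (k_lin_r _ _))
  /k !fglift_U.
Qed.

End KShOp.

Lemma KSh_prec_bilinear : bilinear KSh_prec.
Proof. by apply: KSh_op_bilinear => a b; exact: Sh_prec_bilinear. Qed.

Lemma KSh_succ_bilinear : bilinear KSh_succ.
Proof. by apply: KSh_op_bilinear => a b; exact: Sh_succ_bilinear. Qed.

Lemma KSh_prec_tens a b x y :
  KSh_prec (<< a >> ⊗ x) (<< b >> ⊗ y) = << a ← b >> ⊗ (x ≺_(a ◁ b) y).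
Proof. by apply: KSh_op_tens => ? ?; exact: Sh_prec_bilinear. Qed.

Lemma KSh_succ_tens a b x y :
  KSh_succ (<< a >> ⊗ x) (<< b >> ⊗ y) = << a → b >> ⊗ (x ≻_(a ▷ b) y).
Proof. by apply: KSh_op_tens => ? ?; exact: Sh_succ_bilinear. Qed.

Definition KSh_gen (a : Omega) (v : V) : KSh := << a >> ⊗ word (tlet Omega v).

End TypedProducts.

Section Dendriform.
Variables (K : fieldType) (A : lmodType K).
Implicit Types (prec succ : A -> A -> A) (Delta : A -> (A ⊗ A)%type).

Record dendriform prec succ : Prop := Dendriform {
  dend_prec_bilinear : bilinear prec;
  dend_succ_bilinear : bilinear succ;
  dend_prec_prec : forall x y z,
    prec (prec x y) z = prec x (prec y z + succ y z);
  dend_succ_prec : forall x y z, prec (succ x y) z = succ x (prec y z);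
  dend_succ_succ : forall x y z,
    succ (prec x y + succ x y) z = succ x (succ y z)
}.

Definition tassoc (p : ((A ⊗ A) ⊗ A)%type) : (A ⊗ (A ⊗ A))%type :=
  tlift (fun q z => tlift (fun x y => x ⊗ (y ⊗ z)) q) p.

(* (Delta ⊗ Id) o Delta = (Id ⊗ Delta) o Delta.                                *)
Definition coassociative Delta : Prop := forall x,
  tassoc (tlift (fun x1 x2 => Delta x1 ⊗ x2) (Delta x)) =
  tlift (fun x1 x2 => x1 ⊗ Delta x2) (Delta x).

Record dendriform_bialgebra prec succ Delta : Prop := DendriformBialgebra {
  dbi_dendriform : dendriform prec succ;
  dbi_linear : linear Delta;
  dbi_coassociative : coassociative Delta;
  dbi_prec : forall x y,
    let mul a b := prec a b + succ a b in
    Delta (prec x y) =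
      x ⊗ y
      + tlift (fun x1 x2 => prec x1 y ⊗ x2) (Delta x)
      + tlift (fun x1 x2 => x1 ⊗ mul x2 y) (Delta x)
      + tlift (fun y1 y2 => prec x y1 ⊗ y2) (Delta y)
      + tlift (fun x1 x2 => tlift (fun y1 y2 =>
          prec x1 y1 ⊗ mul x2 y2) (Delta y)) (Delta x);
  dbi_succ : forall x y,
    let mul a b := prec a b + succ a b in
    Delta (succ x y) =
      y ⊗ x
      + tlift (fun x1 x2 => succ x1 y ⊗ x2) (Delta x)
      + tlift (fun y1 y2 => y1 ⊗ mul x y2) (Delta y)
      + tlift (fun y1 y2 => succ x y1 ⊗ y2) (Delta y)
      + tlift (fun x1 x2 => tlift (fun y1 y2 =>
          succ x1 y1 ⊗ mul x2 y2) (Delta y)) (Delta x)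
}.

End Dendriform.

(* Main.v *)
Require Import Defs.
From mathcomp Require Import all_boot all_algebra.
From mathcomp Require Import boolp classical_sets freeg zify.
Import GRing.Theory.
Local Open Scope ring_scope.

Set Implicit Arguments.
Unset Strict Implicit.
Unset Printing Implicit Defensive.

(* As (a, b) |-> (a ← b, a ◁ b) is bijective, every a ⊗ x with x of length at *)
(* least 2 is g ≺ (b ⊗ y) for a generator g and a word y shorter than x, so   *)
(* the products g1 ≺ (g2 ≺ (... ≺ gn)) of generators span the algebra.        *)
(* If Omega is commutative then x ≻ y = y ≺ x, and the identity               *)
(* (g ≺ x) ≺ y = g ≺ (x ≺ y + y ≺ x) makes ≺ the half-shuffle product of the   *)
(* words g1 ... gn. A coproduct killing the generators must satisfy           *)
(* Delta (g ≺ x) = g ⊗ x + g ≺ x' ⊗ x'', hence is the reduced deconcatenation, *)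
(* which is compatible with the half-shuffle.                                 *)
(* Conversely, applying Delta to a generator product                          *)
(* (a ⊗ v) ≻ (b ⊗ v) = (c ⊗ v) ≺ (d ⊗ v), where a → b = c ← d and             *)
(* a ▷ b = c ◁ d, gives (b ⊗ v) ⊗ (a ⊗ v) = (c ⊗ v) ⊗ (d ⊗ v), so that b = c   *)
(* and a = d.                                                                 *)

(** The algebra is treated abstractly as a space spanned by right-nested products of generators,
    which play the role of words. Knowing ≺ only when a generator stands in front, [nested_zinbiel]
    recovers the Zinbiel identity, that of commutative dendriform algebras, and [zinbiel_bialgebra]
    its compatibility with deconcatenation. The main inductions strip the first generator of a word
    and reduce each identity to shorter arguments. The abstract hypotheses hold for commutative
    Omega: [KSh_prec_gen] is the rule for a leading generator, [KSh_succC] says that ≻ is the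
    opposite of ≺, and [KSh_nested_ext] gets the spanning from nondegeneracy. The coproduct is
    [deconc]; it is unique because [dendriform_bialgebra_prec_primitive] forces its recursion. For
    the converse, [coproduct_commutative] takes coproducts of products of two generators, where one
    tensor survives, x ⊗ y for ≺ and y ⊗ x for ≻; [KSh_gen_tens_inj] then compares types. *)

Local Notation bilinear f := (bilinear_for *:%R *:%R f).
Local Notation "u ⊗ w" := (tens u w)
  (at level 40, left associativity) : ring_scope.
Local Notation "U ⊗ W" := (tensor U W)
  (at level 40, left associativity) : type_scope.

(** * Linear and bilinear maps given by bare predicates, and Sweedler sums *)

Section RawLinear.
Variable K : fieldType.

Lemma raw_linear0 (U E : lmodType K) (h : U -> E) : linear h -> h 0 = 0.
Proof. by move=> l; move: (l (-1) 0 0); rewrite !scaleN1r !addNr. Qed.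

Lemma raw_linearD (U E : lmodType K) (h : U -> E) : linear h ->
  {morph h : x y / x + y}.
Proof. by move=> l x y; move: (l 1 x y); rewrite !scale1r. Qed.

Lemma raw_linear_add (U E : lmodType K) (f g : U -> E) :
  linear f -> linear g -> linear (fun x => f x + g x).
Proof. by move=> lf lg c x y; rewrite lf lg scalerDr addrACA. Qed.

Variables (U W E : lmodType K).

Lemma bilinear0l (f : U -> W -> E) w : bilinear f -> f 0 w = 0.
Proof. by case=> l _; exact: (raw_linear0 (l w)). Qed.

Lemma bilinearDl (f : U -> W -> E) : bilinear f ->
  forall u u' w, f (u + u') w = f u w + f u' w.
Proof. by case=> l _ u u' w; exact: (raw_linearD (l w)). Qed.

Lemma bilinearDr (f : U -> W -> E) : bilinear f ->
  forall u w w', f u (w + w') = f u w + f u w'.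
Proof. by case=> _ l u; exact: (raw_linearD (l u)). Qed.

Lemma bilinear_tens (U' W' : lmodType K) (F : U' -> U) (G : W' -> W) :
  linear F -> linear G -> bilinear (fun u w => F u ⊗ G w).
Proof.
move=> lF lG; split=> [w c u u' | u c w w'] /=.
  by rewrite lF (tens_bilinear _ _).1.
by rewrite lG (tens_bilinear _ _).2.
Qed.

Lemma bilinear_comp2l (p : U -> U -> U) g : bilinear p ->
  bilinear (fun x y => p (p g x) y).
Proof.
by case=> pl pr; split=> [y|x] c u v /=; rewrite pr ?pl.
Qed.

Lemma bilinear_comp2r (p s : U -> U -> U) g : bilinear p -> bilinear s ->
  bilinear (fun x y => p g (p x y + s x y)).
Proof.
case=> pl pr [sl sr]; split=> [y|x] c u v /=.
  by rewrite pl sl -(pr g) scalerDr addrACA.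
by rewrite pr sr -(pr g) scalerDr addrACA.
Qed.

End RawLinear.

Section TensorLift.
Variables (K : fieldType) (U W E : lmodType K).
Implicit Types (f g : U -> W -> E) (z : U ⊗ W).

Lemma tlift0 f : bilinear f -> tlift f 0 = 0.
Proof. by move=> bf; exact: raw_linear0 (tlift_linear bf). Qed.

(** All three lifts are evaluated on the same representative of z, so the identity is termwise. *)
Lemma tliftD f g z :
  tlift (fun u w => f u w + g u w) z = tlift f z + tlift g z.
Proof.
rewrite -[tlift f z]scale1r -tlift_lin; apply: eq_tlift => u w.
by rewrite scale1r.
Qed.

Lemma linear_tlift (E' : lmodType K) (h : E -> E') f z :
  linear h -> bilinear f -> h (tlift f z) = tlift (fun u w => h (f u w)) z.
Proof.
move=> lh bf; have bhf : bilinear (fun u w => h (f u w)).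
  by split=> [w c u u' | u c w w'] /=; rewrite ?bf.1 ?bf.2 lh.
apply: (@tensor_ext _ _ _ _ (fun z => h (tlift f z)) (tlift _)).
- by move=> c x y; rewrite (tlift_linear bf) lh.
- exact: tlift_linear.
by move=> u w; rewrite !tlift_tens.
Qed.

Lemma bilinear_tens_tlift (U' W' P Q : lmodType K) (F : U -> U' -> P)
    (G : W -> W' -> Q) (z : U' ⊗ W') : bilinear F -> bilinear G ->
  bilinear (fun u w => tlift (fun u' w' => F u u' ⊗ G w w') z).
Proof.
move=> bF bG; split=> [w c u u' | u c w w'] /=; rewrite -tlift_lin;
  apply: eq_tlift => p q.
  by rewrite bF.1 (tens_bilinear _ _).1.
by rewrite bG.1 (tens_bilinear _ _).2.
Qed.

(** Fubini for double Sweedler sums: bilinearity reduces z to a pure tensor, where both sides are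
    one lift over t. *)
Lemma tlift_exchange (U' W' : lmodType K) (f : U -> W -> U' -> W' -> E)
    (z : U ⊗ W) (t : U' ⊗ W') :
  (forall u w, bilinear (f u w)) ->
  (forall u' w', bilinear (fun u w => f u w u' w')) ->
  tlift (fun u w => tlift (f u w) t) z =
  tlift (fun u' w' => tlift (fun u w => f u w u' w') z) t.
Proof.
move=> bf bf'.
have b1 t' : bilinear (fun u w => tlift (f u w) t').
  split=> [w c u u' | u c w w']; rewrite -tlift_lin; apply: eq_tlift => p q.
    by rewrite (bf' p q).1.
  by rewrite (bf' p q).2.
apply: (@tensor_ext _ _ _ _ (tlift _)
  (fun z => tlift (fun u' w' => tlift (fun u w => f u w u' w') z) t)).
- exact: tlift_linear.
- move=> c x y; rewrite -tlift_lin; apply: eq_tlift => p q.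
  exact: (tlift_linear (bf' p q)).
move=> u w; rewrite tlift_tens //; apply: eq_tlift => p q.
by rewrite tlift_tens.
Qed.

End TensorLift.

(** * Zinbiel algebras spanned by nested products of generators *)

Section HalfShuffle.
Variables (K : fieldType) (A : lmodType K) (I : Type).
Variables (gen : I -> A) (prec : A -> A -> A).

(** The words in the generators; the index counts the products and measures size in the
    inductions. *)
Inductive nested : nat -> A -> Prop :=
| NestedGen i : nested 0 (gen i)
| NestedCons i n x : nested n x -> nested n.+1 (prec (gen i) x).

Let mul x y := prec x y + prec y x.

Hypothesis prec_bilinear : bilinear prec.
(** The Zinbiel identity with a generator in first place, the case that can be read off the
    recursive definition of ≺ on typed words. *)
Hypothesis prec_gen : forall i x y,
  prec (prec (gen i) x) y = prec (gen i) (mul x y).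
(** Spanning by nested products, stated as an extensionality principle for linear maps. *)
Hypothesis nested_ext : forall (E : lmodType K) (h1 h2 : A -> E),
  linear h1 -> linear h2 ->
  (forall n x, nested n x -> h1 x = h2 x) -> h1 =1 h2.

Let precl x : linear (prec^~ x). Proof. exact: prec_bilinear.1. Qed.
Let precr x : linear (prec x). Proof. exact: prec_bilinear.2. Qed.
Let precDl := bilinearDl prec_bilinear.
Let precDr := bilinearDr prec_bilinear.

Let mulr x : linear (mul x).
Proof. exact: (raw_linear_add (precr x) (precl x)). Qed.

Let mulC x y : mul x y = mul y x.
Proof. exact: addrC. Qed.

Let mull x : linear (mul^~ x).
Proof. by move=> c y z; rewrite !(mulC _ x) mulr. Qed.

(** For x = g ≺ a, moving g to the front on both sides leaves the associativity of [mul] on a, y, z.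
    Expanded, it follows from the identity for the triples (a, y, z), (y, a, z), (y, z, a) and (z,
    y, a), all of smaller total size. *)
Lemma nested_zinbiel m n p x y z :
  nested m x -> nested n y -> nested p z ->
  prec (prec x y) z = prec x (mul y z).
Proof.
have [N] := ubnP (m + n + p)%N.
elim: N m n p x y z => // N IH m n p x y z le nx ny nz.
case: nx le => [i | i k a na] le; first exact: prec_gen.
rewrite !prec_gen; congr prec.
have [l1 l2 l3 l4] : [/\ k + n + p < N, n + k + p < N, p + n + k < N
    & n + p + k < N]%N.
  by split; lia.
rewrite /mul !(precDl, precDr) (IH k n p) // (IH n k p) // (IH n p k) //.
rewrite (IH p n k) // /mul !(precDl, precDr) -addrA.
by congr (_ + (_ + _)); exact: addrC.
Qed.

Let zinbiel x y z : prec (prec x y) z = prec x (mul y z).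
Proof.
apply: (nested_ext (h1 := fun x => prec (prec x y) z)
  (h2 := fun x => prec x (mul y z))) => [c u v|c u v|m {}x nx];
  rewrite ?precl //.
apply: (nested_ext (h1 := fun y => prec (prec x y) z)
  (h2 := fun y => prec x (mul y z))) => [c u v|c u v|n {}y ny];
  rewrite ?(precr x, precl z, mull z) //.
apply: (nested_ext (h1 := prec (prec x y)) (h2 := fun z => prec x (mul y z)))
  => [c u v|c u v|p {}z nz]; rewrite ?(precr, mulr) //.
exact: nested_zinbiel nx ny nz.
Qed.

Lemma zinbiel_dendriform : dendriform prec (fun x y => prec y x).
Proof.
split=> [|||x y z|x y z]; first exact: prec_bilinear.
- by split=> [y|x]; [exact: precr | exact: precl].
- exact: zinbiel.
- by rewrite !zinbiel mulC.
- by rewrite zinbiel mulC.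
Qed.

(** * Deconcatenation and its compatibility with the half-shuffle *)

Variable Delta : A -> (A ⊗ A)%type.
Hypothesis Delta_linear : linear Delta.
Hypothesis Delta_gen : forall i, Delta (gen i) = 0.
Hypothesis Delta_cons : forall i x,
  Delta (prec (gen i) x) =
  gen i ⊗ x + tlift (fun x1 x2 => prec (gen i) x1 ⊗ x2) (Delta x).

Let tensl (x : A) : linear (fun y : A => y ⊗ x).
Proof. exact: (tens_bilinear A A).1. Qed.
Let tensr (x : A) : linear (tens x : A -> _).
Proof. exact: (tens_bilinear A A).2. Qed.
Let DeltaD := raw_linearD Delta_linear.

Let id_linear : linear (fun x : A => x).
Proof. by []. Qed.

Lemma nested_coassociative : coassociative Delta.
Proof.
have inner_bl (z : A) : bilinear (fun x y : A => x ⊗ (y ⊗ z)).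
  exact: (bilinear_tens id_linear (tensl z)).
have tassoc_bl : bilinear (fun (q : (A ⊗ A)%type) (z : A) =>
    tlift (fun x y => x ⊗ (y ⊗ z)) q).
  split=> [z c p q | q c z z']; first exact: (tlift_linear (inner_bl z)).
  rewrite -tlift_lin; apply: eq_tlift => u w.
  by rewrite tensr (tens_bilinear _ _).2.
have tassoc_linear := tlift_linear tassoc_bl.
have Dl_bl : bilinear (fun x1 x2 : A => Delta x1 ⊗ x2).
  exact: (bilinear_tens Delta_linear id_linear).
have Dr_bl : bilinear (fun x1 x2 : A => x1 ⊗ Delta x2).
  exact: (bilinear_tens id_linear Delta_linear).
apply: (nested_ext (h1 := fun x =>
    tassoc (tlift (fun x1 x2 => Delta x1 ⊗ x2) (Delta x)))).
- move=> c x y; rewrite Delta_linear (tlift_linear Dl_bl).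
  exact: tassoc_linear.
- by move=> c x y; rewrite Delta_linear (tlift_linear Dr_bl).
move=> n x; elim=> {n x} [i | i n x _ IH].
  by rewrite Delta_gen !tlift0 // /tassoc tlift0.
set g := gen i.
(* [P] and [Q] apply g ≺ _ to the first tensor factor. They commute with reassociation and with
   Delta on the last factor, whereas Delta on the first factor creates an extra g ⊗ z; this matches
   the g ⊗ Delta x coming from the other side. *)
pose P (z : (A ⊗ A)%type) := tlift (fun x1 x2 => prec g x1 ⊗ x2) z.
have P_bl : bilinear (fun x1 x2 : A => prec g x1 ⊗ x2).
  exact: (bilinear_tens (precr g) id_linear).
pose Q (z : (A ⊗ (A ⊗ A))%type) := tlift (fun x1 z2 => prec g x1 ⊗ z2) z.
have Q_bl : bilinear (fun x1 (z2 : (A ⊗ A)%type) => prec g x1 ⊗ z2).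
  by apply: (bilinear_tens (precr g)).
have P_tassoc w z : tassoc (P w ⊗ z) = Q (tassoc (w ⊗ z)).
  rewrite /tassoc !tlift_tens //.
  apply: (@tensor_ext _ _ _ _ (fun w => tlift _ (P w))
    (fun w => Q (tlift _ w))).
  - by move=> c x' y'; rewrite /P (tlift_linear P_bl) (tlift_linear (inner_bl z)).
  - by move=> c x' y'; rewrite /Q (tlift_linear (inner_bl z)) (tlift_linear Q_bl).
  by move=> u v; rewrite /P /Q !tlift_tens.
have QD : forall z, tlift (fun x1 x2 => x1 ⊗ Delta x2) (P z) =
    Q (tlift (fun x1 x2 => x1 ⊗ Delta x2) z).
  apply: tensor_ext => [c x' y'|c x' y'|u v].
  - by rewrite /P (tlift_linear P_bl) (tlift_linear Dr_bl).
  - by rewrite /Q (tlift_linear Dr_bl) (tlift_linear Q_bl).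
  by rewrite /P /Q !tlift_tens.
have PD : forall z, tassoc (tlift (fun x1 x2 => Delta x1 ⊗ x2) (P z)) =
    g ⊗ z + Q (tassoc (tlift (fun x1 x2 => Delta x1 ⊗ x2) z)).
  apply: tensor_ext => [c x' y'|c x' y'|u v].
  - by rewrite /P (tlift_linear P_bl) (tlift_linear Dl_bl) /tassoc tassoc_linear.
  - rewrite (tlift_linear Dl_bl) /tassoc tassoc_linear /Q (tlift_linear Q_bl).
    by rewrite (tens_bilinear _ _).2 scalerDr addrACA.
  rewrite /P !tlift_tens // Delta_cons.
  rewrite (bilinearDl (tens_bilinear _ _)) -/(P (Delta u)) -P_tassoc /tassoc.
  by rewrite (raw_linearD tassoc_linear) !tlift_tens.
rewrite Delta_cons -/(P (Delta x)) (raw_linearD (tlift_linear Dr_bl)) QD -IH.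
rewrite tlift_tens // (raw_linearD (tlift_linear Dl_bl)) tlift_tens //.
rewrite Delta_gen (bilinear0l _ (tens_bilinear _ _)) add0r.
exact: PD.
Qed.

Let tens_mul_bl (F : A -> A -> A) (y : A ⊗ A) : bilinear F ->
  bilinear (fun u w => tlift (fun u' w' => F u u' ⊗ mul w w') y).
Proof. by move=> bF; apply: bilinear_tens_tlift. Qed.

Let Delta_prec_rhs (x y : A) :=
  x ⊗ y
  + tlift (fun x1 x2 => prec x1 y ⊗ x2) (Delta x)
  + tlift (fun x1 x2 => x1 ⊗ mul x2 y) (Delta x)
  + tlift (fun y1 y2 => prec x y1 ⊗ y2) (Delta y)
  + tlift (fun x1 x2 => tlift (fun y1 y2 =>
      prec x1 y1 ⊗ mul x2 y2) (Delta y)) (Delta x).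

(** For x = g ≺ a, the left side is Delta (g ≺ (a ≺ y + y ≺ a)); the recursion for Delta and the
    induction hypothesis for (a, y) and (y, a) give eleven terms. On the right, expanding Delta x
    and splitting each (g ≺ u) ≺ v by [zinbiel] gives the same eleven. *)
Lemma nested_Delta_prec m n x y :
  nested m x -> nested n y -> Delta (prec x y) = Delta_prec_rhs x y.
Proof.
have [N] := ubnP (m + n)%N; elim: N m n x y => // N IH m n x y le nx ny.
case: nx le => [i | i k a na] le.
  rewrite Delta_cons /Delta_prec_rhs Delta_gen !tlift0 ?addr0 //.
  - exact: tens_mul_bl.
  - exact: (bilinear_tens id_linear (mull y)).
  - exact: (bilinear_tens (precl y) id_linear).
set g := gen i.
pose L (z : A ⊗ A) := tlift (fun x1 x2 => prec g x1 ⊗ x2) z.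
have L_bl : bilinear (fun x1 x2 : A => prec g x1 ⊗ x2).
  exact: (bilinear_tens (precr g) id_linear).
have L_linear : linear L by exact: tlift_linear.
have LD := raw_linearD L_linear.
have LT u w : L (u ⊗ w) = prec g u ⊗ w by rewrite /L tlift_tens.
have LL (F G : A -> A) z : linear F -> linear G ->
    L (tlift (fun u w => F u ⊗ G w) z) = tlift (fun u w => prec g (F u) ⊗ G w) z.
  move=> lF lG; rewrite (linear_tlift _ L_linear) ?LT; last exact: bilinear_tens.
  by apply: eq_tlift => u w; rewrite LT.
have LLL (F : A -> A -> A) z t : bilinear F ->
    L (tlift (fun u w => tlift (fun u' w' => F u u' ⊗ mul w w') t) z) =
    tlift (fun u w => tlift (fun u' w' => prec g (F u u') ⊗ mul w w') t) z.
  move=> bF; rewrite (linear_tlift _ L_linear); last exact: tens_mul_bl.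
  apply: eq_tlift => u w; exact: (LL (F u) (mul w) _ (bF.2 u) (mulr w)).
have LR (f : A -> A -> A ⊗ A) z : bilinear f ->
    tlift f (g ⊗ a + L z) = f g a + tlift (fun u w => f (prec g u) w) z.
  move=> bf; rewrite (raw_linearD (tlift_linear bf)) tlift_tens //.
  rewrite (linear_tlift _ (tlift_linear bf) L_bl); congr (_ + _).
  by apply: eq_tlift => u w; rewrite tlift_tens.
have Da : Delta (prec g a) = g ⊗ a + L (Delta a) by rewrite Delta_cons.
rewrite prec_gen Delta_cons -/(L _) -/g /mul DeltaD.
rewrite (IH k n) ?(IH n k) //; [|lia..].
rewrite /Delta_prec_rhs !LD !LT.
rewrite !LL // !LLL // Da !LR;
  [| exact: tens_mul_bl | exact: (bilinear_tens id_linear (mull y))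
   | exact: (bilinear_tens (precl y) id_linear)].
have gD u v w : prec (prec g u) v ⊗ w =
    prec g (prec u v) ⊗ w + prec g (prec v u) ⊗ w.
  by rewrite zinbiel /mul precDr (bilinearDl (tens_bilinear _ _)).
have -> : tlift (fun u w => prec (prec g u) y ⊗ w) (Delta a) =
    tlift (fun u w => prec g (prec u y) ⊗ w) (Delta a) +
    tlift (fun u w => prec g (prec y u) ⊗ w) (Delta a).
  by rewrite -tliftD; apply: eq_tlift => u w; exact: gD.
have -> : tlift (fun u w => prec (prec g a) u ⊗ w) (Delta y) =
    tlift (fun u w => prec g (prec a u) ⊗ w) (Delta y) +
    tlift (fun u w => prec g (prec u a) ⊗ w) (Delta y).
  by rewrite -tliftD; apply: eq_tlift => u w; exact: gD.
(* Of the two halves given by [zinbiel], the second comes from Delta (y ≺ a), where the sums over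
   Delta a and Delta y are nested in the other order. *)
rewrite [X in _ = _ + (_ + X)](_ : _ =
  tlift (fun u w => tlift (fun p q => prec g (prec u p) ⊗ mul w q) (Delta y))
    (Delta a) +
  tlift (fun u w => tlift (fun p q => prec g (prec u p) ⊗ mul w q) (Delta a))
    (Delta y)); last first.
  rewrite [X in _ = _ + X]tlift_exchange; first last.
  - move=> p q; apply: (bilinear_tens _ (mull q)) => c u v.
    by rewrite precl precr.
  - move=> p q; apply: (bilinear_tens _ (mulr q)) => c u v.
    by rewrite !precr.
  rewrite -tliftD; apply: eq_tlift => u w; rewrite -tliftD.
  by apply: eq_tlift => p q; rewrite (mulC q w); exact: gD.
have -> : tlift (fun u w => prec g u ⊗ mul w a) (Delta y) =
    tlift (fun u w => prec g u ⊗ mul a w) (Delta y).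
  by apply: eq_tlift => u w; rewrite mulC.
rewrite -/(mul a y).
(* Summand 1 is g ⊗ [mul a y]; summands 2 to 6 come from a ≺ y and 7 to 11 from y ≺ a. The second
   pattern groups them by the five terms of the right side. *)
by rewrite [LHS](AC (1*(5*5))
  (2*(7*(3*10))*(1*4)*(5*8)*(9*(6*11))))%AC.
Qed.

Let Delta_prec_rhs_bilinear : bilinear Delta_prec_rhs.
Proof.
split=> [y|x]; refine (raw_linear_add (raw_linear_add (raw_linear_add
  (raw_linear_add _ _) _) _) _).
- exact: tensl.
- move=> c u v; rewrite Delta_linear.
  exact: (tlift_linear (bilinear_tens (precl y) id_linear)).
- move=> c u v; rewrite Delta_linear.
  exact: (tlift_linear (bilinear_tens id_linear (mull y))).
- move=> c u v; rewrite -tlift_lin; apply: eq_tlift => p q.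
  by rewrite precl tensl.
- move=> c u v; rewrite Delta_linear.
  exact: (tlift_linear (tens_mul_bl _ prec_bilinear)).
- exact: tensr.
- move=> c u v; rewrite -tlift_lin; apply: eq_tlift => p q.
  by rewrite precr tensl.
- move=> c u v; rewrite -tlift_lin; apply: eq_tlift => p q.
  by rewrite mulr tensr.
- move=> c u v; rewrite Delta_linear.
  exact: (tlift_linear (bilinear_tens (precr x) id_linear)).
move=> c u v; rewrite -tlift_lin; apply: eq_tlift => p q.
by rewrite Delta_linear; exact: (tlift_linear (bilinear_tens (precr p) (mulr q))).
Qed.

Let Delta_prec x y : Delta (prec x y) = Delta_prec_rhs x y.
Proof.
apply: (nested_ext (h1 := fun x => Delta (prec x y))
  (h2 := Delta_prec_rhs^~ y)) => [c u v||m {}x nx].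
- by rewrite precl Delta_linear.
- exact: Delta_prec_rhs_bilinear.1.
apply: (nested_ext (h1 := fun y => Delta (prec x y))
  (h2 := Delta_prec_rhs x)) => [c u v||n {}y ny].
- by rewrite precr Delta_linear.
- exact: Delta_prec_rhs_bilinear.2.
exact: nested_Delta_prec nx ny.
Qed.

Lemma zinbiel_bialgebra : dendriform_bialgebra prec (fun x y => prec y x) Delta.
Proof.
split=> [|||x y /=|x y /=]; [exact: zinbiel_dendriform | exact: Delta_linear
  | exact: nested_coassociative | exact: Delta_prec |].
(* The formula for x ≻ y is that for y ≺ x, up to the order of the Sweedler sums and commutativity
   of [mul]. *)
rewrite Delta_prec /Delta_prec_rhs tlift_exchange; first last.
- by move=> p q; exact: (bilinear_tens (precl p) (mull q)).
- by move=> p q; exact: (bilinear_tens (precr p) (mulr q)).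
rewrite [LHS](AC 5 (1*4*3*2*5))%AC; congr (_ + _ + _ + _ + _).
  by apply: eq_tlift => u w; rewrite mulC.
by apply: eq_tlift => u w; apply: eq_tlift => p q; rewrite mulC.
Qed.

Lemma nested_Delta_unique (Delta' : A -> (A ⊗ A)%type) : linear Delta' ->
  (forall i, Delta' (gen i) = 0) ->
  (forall i x, Delta' (prec (gen i) x) =
    gen i ⊗ x + tlift (fun x1 x2 => prec (gen i) x1 ⊗ x2) (Delta' x)) ->
  Delta = Delta'.
Proof.
move=> lin' gen' cons'; apply: funext.
apply: nested_ext => // n x; elim=> {n x} [i | i n x _ IH].
  by rewrite Delta_gen gen'.
by rewrite Delta_cons cons' IH.
Qed.

End HalfShuffle.

Local Open Scope eds_scope.
Local Notation "a ← b" := (dias_l a b)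
  (at level 40, left associativity) : eds_scope.
Local Notation "a → b" := (dias_r a b)
  (at level 40, left associativity) : eds_scope.
Local Notation "a ◁ b" := (eds_tl a b)
  (at level 40, left associativity) : eds_scope.
Local Notation "a ▷ b" := (eds_tr a b)
  (at level 40, left associativity) : eds_scope.

(** * The products on typed words in terms of generators *)

Section KShTheory.
Variables (K : fieldType) (Omega : edsType) (V : lmodType K).
Local Notation KSh := (KSh Omega V).
Local Notation prec := (@KSh_prec K Omega V).
Local Notation succ := (@KSh_succ K Omega V).
Local Notation gen := (@KSh_gen K Omega V).
Local Notation word := (@word K Omega V).

Lemma KSh_ext (E : lmodType K) (h1 h2 : KSh -> E) : linear h1 -> linear h2 ->
  (forall a x, h1 (<< a >> ⊗ word x) = h2 (<< a >> ⊗ word x)) -> h1 =1 h2.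
Proof.
move=> l1 l2 h; apply: tensor_ext => // al z.
apply: (freeg_ext (h1 := fun al => h1 (al ⊗ z)) (h2 := fun al => h2 (al ⊗ z)))
  => [c u v|c u v|a].
- by rewrite (tens_bilinear _ _).1 l1.
- by rewrite (tens_bilinear _ _).1 l2.
apply: (Sh_ext (h1 := fun z => h1 (<< a >> ⊗ z))
  (h2 := fun z => h2 (<< a >> ⊗ z))) => [c u v|c u v|x].
- by rewrite (tens_bilinear _ _).2 l1.
- by rewrite (tens_bilinear _ _).2 l2.
exact: h.
Qed.

Lemma KSh_gen_linear a : linear (gen a).
Proof.
move=> c u v; rewrite /KSh_gen -(tens_bilinear _ _).2; congr tens.
by apply: word_multilinear; constructor.
Qed.

Lemma KSh_prec_gen_tens a b v z :
  prec (gen a v) (<< b >> ⊗ z) = << a ← b >> ⊗ Sh_cons (a ◁ b) v z.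
Proof.
rewrite /KSh_gen KSh_prec_tens; congr tens.
apply: (Sh_ext (h1 := Sh_prec (a ◁ b) (word (tlet _ v)))) => [||x].
- exact: (Sh_prec_bilinear V (a ◁ b)).2.
- exact: Sh_cons_linear.
exact: Sh_prec_let.
Qed.

Lemma KSh_prec_gen_word a b v x :
  prec (gen a v) (<< b >> ⊗ word x) = << a ← b >> ⊗ word (tcons (a ◁ b) v x).
Proof. by rewrite KSh_prec_gen_tens Sh_cons_word. Qed.

Lemma KSh_succ_gen a b v w :
  succ (gen a v) (gen b w) = << a → b >> ⊗ word (tcons (a ▷ b) w (tlet _ v)).
Proof. by rewrite /KSh_gen KSh_succ_tens Sh_succ_let Sh_cons_word. Qed.

(** On basis elements, the recursion for ≺ on a word with head v agrees with the right side by the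
    four EDS axioms combining a ◁ b with (a ← b) ◁ d, together with the diassociative laws for ←. *)
Lemma KSh_prec_gen a v x y :
  prec (prec (gen a v) x) y = prec (gen a v) (prec x y + succ x y).
Proof.
have bp := KSh_prec_bilinear Omega V; have bs := KSh_succ_bilinear Omega V.
have lb := bilinear_comp2l (gen a v) bp.
have rb := bilinear_comp2r (gen a v) bp bs.
apply: (KSh_ext (lb.1 y) (rb.1 y)) => b {}x.
apply: (KSh_ext (lb.2 (<< b >> ⊗ word x)) (rb.2 (<< b >> ⊗ word x))) => d {}y.
rewrite KSh_prec_gen_word (KSh_prec_tens (a ← b) d) (KSh_prec_tens b d).
rewrite (KSh_succ_tens b d) (bilinearDr bp) !KSh_prec_gen_tens Sh_prec_cons.
rewrite (bilinearDr (tens_bilinear _ _)) eds_tl_ll eds_tl_tl eds_tl_lr eds_tl_tr.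
by rewrite -(dias_llrA a b d) dias_llA.
Qed.

Hypothesis Omega_commutative : eds_commutative Omega.

(** The recursion for ≻ on the head of y is the one for ≺ with arguments exchanged; commutativity of
    Omega swaps its two summands. *)
Lemma word_succC (x y : tword Omega V) a :
  (word_prods x y).2 a = (word_prods y x).1 a.
Proof.
case: Omega_commutative => rC trC.
have [N] := ubnP (ntypes x + ntypes y)%N; elim: N x y a => // N IH x y a le.
rewrite word_succE word_precE; case: y le => [//|b w y] /= le.
by rewrite !rC !trC (IH x y) ?(IH y x) 1?addrC //; lia.
Qed.

Lemma KSh_succC x y : succ x y = prec y x.
Proof.
have [bp bs] := (KSh_prec_bilinear Omega V, KSh_succ_bilinear Omega V).
apply: (KSh_ext (bs.1 y) (bp.2 y)) => a {}x.
apply: (KSh_ext (bs.2 (<< a >> ⊗ word x)) (bp.1 (<< a >> ⊗ word x))) => b {}y.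
case: Omega_commutative => rC trC.
rewrite KSh_succ_tens KSh_prec_tens rC trC; congr tens.
by rewrite Sh_succ_words Sh_prec_words word_succC.
Qed.

(** * Factoring words into generators, and the deconcatenation coproduct *)

Variable inv : Omega * Omega -> Omega * Omega.
Hypothesis invK : cancel inv (fun p => (p.1 ← p.2, p.1 ◁ p.2)).
Hypothesis Kinv : cancel (fun p => (p.1 ← p.2, p.1 ◁ p.2)) inv.

Let I : Type := (Omega * V)%type.
Let geni (i : I) : KSh := gen i.1 i.2.

(** Surjectivity of (b, e) ↦ (b ← e, b ◁ e) writes the outer type and the first inner type through
    one pair, so the head letter splits off as a generator. *)
Lemma nested_word x a : nested geni prec (ntypes x) (<< a >> ⊗ word x).
Proof.
elim: x a => [v | d v x IH] a /=; first exact: (NestedGen geni prec (a, v)).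
have := invK (a, d); case: (inv _) => b e /= [<- <-].
by rewrite -KSh_prec_gen_word; exact: (NestedCons (b, v)).
Qed.

Lemma KSh_nested_ext (E : lmodType K) (h1 h2 : KSh -> E) :
  linear h1 -> linear h2 ->
  (forall n x, nested geni prec n x -> h1 x = h2 x) -> h1 =1 h2.
Proof.
by move=> l1 l2 h; apply: KSh_ext => // a x; apply: h; exact: nested_word.
Qed.

(* With (b, e) = inv (a, d), the basis word a ⊗ (tcons d v y) is the product  *)
(* (b ⊗ v) ≺ (e ⊗ y), and b and e are p.1 and p.2 below.                     *)
Fixpoint word_deconc (x : tword Omega V) (a : Omega) : (KSh ⊗ KSh)%type :=
  if x is tcons d v y then
    let p := inv (a, d) in
    gen p.1 v ⊗ (<< p.2 >> ⊗ word y) +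
    tlift (fun x1 x2 => prec (gen p.1 v) x1 ⊗ x2) (word_deconc y p.2)
  else 0.

Let head_bilinear (g : KSh) :
  bilinear (fun x1 x2 : KSh => prec g x1 ⊗ x2).
Proof.
by apply: (bilinear_tens (G := fun x => x)) => //;
  exact: (KSh_prec_bilinear Omega V).2.
Qed.

Lemma word_deconc_multilinear a : multilinear (word_deconc^~ a).
Proof.
move=> c x x1 x2 xl.
elim: {x x1 x2} xl a => [u u' | b u u' x | b v x x1 x2 xl IH] a /=.
- by rewrite scaler0 addr0.
- set p := inv _; rewrite KSh_gen_linear.
  rewrite (tens_bilinear _ _).1 scalerDr addrACA; congr (_ + _).
  rewrite -tlift_lin; apply: eq_tlift => y z.
  by rewrite (KSh_prec_bilinear Omega V).1 (tens_bilinear _ _).1.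
set p := inv _; rewrite (word_multilinear xl) !(tens_bilinear _ _).2 IH.
by rewrite (tlift_linear (head_bilinear _)) scalerDr addrACA.
Qed.

Definition deconc (z : KSh) : (KSh ⊗ KSh)%type :=
  tlift (fun al x => fglift (fun a => Sh_lift (word_deconc^~ a) x) al) z.

Lemma deconc_bilinear :
  bilinear (fun al (x : Sh Omega V) =>
    fglift (fun a => Sh_lift (word_deconc^~ a) x) al).
Proof.
split=> [x|al] c u v; first exact: fglift_linear.
rewrite -fglift_lin; apply: eq_fglift => a.
exact: (Sh_lift_linear (word_deconc_multilinear a)).
Qed.

Lemma deconc_linear : linear deconc.
Proof. exact: (tlift_linear deconc_bilinear). Qed.

Lemma deconc_word a x : deconc (<< a >> ⊗ word x) = word_deconc x a.
Proof.
rewrite /deconc (tlift_tens _ _ deconc_bilinear) fglift_U.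
exact: (Sh_lift_word _ (word_deconc_multilinear a)).
Qed.

Lemma deconc_gen i : deconc (geni i) = 0.
Proof. exact: deconc_word. Qed.

Lemma deconc_cons i x : deconc (prec (geni i) x) =
  geni i ⊗ x + tlift (fun x1 x2 => prec (geni i) x1 ⊗ x2) (deconc x).
Proof.
case: i => a v; rewrite /geni /=; set g := gen a v.
have pg := (KSh_prec_bilinear Omega V).2 g.
apply: (KSh_ext (h1 := fun x => deconc (prec g x)) (h2 := fun x =>
  g ⊗ x + tlift (fun x1 x2 => prec g x1 ⊗ x2) (deconc x))) => [||b {}x].
- by move=> c y z; rewrite pg; exact: deconc_linear.
- apply: raw_linear_add; first exact: (tens_bilinear _ _).2.
  move=> c y z; rewrite deconc_linear.
  exact: (tlift_linear (head_bilinear g)).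
(* Injectivity: [Kinv] shows that the factorization chosen by [word_deconc] is the given one. *)
by rewrite KSh_prec_gen_word !deconc_word /= (Kinv (a, b)).
Qed.

End KShTheory.

(** * Linear functionals that detect a nonzero vector *)

Section Functional.
Variables (K : fieldType) (V : lmodType K).
Local Open Scope classical_set_scope.

(* For a maximal submodule X avoiding v, V = X ⊕ K v: take the coordinate     *)
(* along v.                                                                   *)
Lemma exists_functional (v : V) : v != 0 ->
  exists2 f : V -> K^o, linear f & f v = 1.
Proof.
move=> v0.
pose sub (X : set V) := ~ X v /\ forall c x y, X x -> X y -> X (c *: x + y).
have [X [[Xv XZ] Xmax]] : exists X, sub X /\ forall Y, X `<` Y -> ~ sub Y.
  apply: Zorn_bigcup => F FP tot.
  split=> [[Y FY Yv] | c x y [Y FY Yx] [Z FZ Zy]].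
    by have [] := FP _ FY.
  have [YZ|ZY] := tot _ _ FY FZ.
    by exists Z => //; apply: (FP _ FZ).2 => //; exact: YZ.
  by exists Y => //; apply: (FP _ FY).2 => //; exact: ZY.
have X0 : X 0.
  apply: contrapT => nX0; apply: (Xmax (X `|` [set 0])).
    split; first exact: subsetUl.
    by move=> /(_ 0); apply: contra_not nX0; apply; right.
  split=> [[//|/= vE]|c x y]; first by rewrite vE eqxx in v0.
  move=> [Xx|/= ->] [Xy|/= ->].
  - by left; exact: XZ.
  - case: nX0; rewrite -(subrr x) -scaleN1r addrC; exact: XZ.
  - by left; rewrite scaler0 add0r.
  by right; rewrite scaler0 addr0.
have XZ' c x : X x -> X (c *: x) by move=> Xx; rewrite -[c *: x]addr0; exact: XZ.
have dec u : exists a : K, X (u - a *: v).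
  have [Xu|Xu] := pselect (X u); first by exists 0; rewrite scale0r subr0.
  (* [Y] is X + K u. It is closed and strictly larger than X, so by maximality it contains v;
     solving for u gives its coordinate. *)
  pose Y := [set w | exists x c, X x /\ w = c *: u + x].
  have XY : X `<` Y.
    split=> [x Xx | YX]; first by exists x, 0; rewrite scale0r add0r.
    by apply: Xu; apply: YX; exists 0, 1; rewrite scale1r addr0.
  have Yv : Y v.
    apply: contrapT => nYv; apply: (Xmax _ XY); split=> // c _ _
      [x [a [Xx ->]]] [y [b [Xy ->]]].
    exists (c *: x + y), (c * a + b); split; first exact: XZ.
    by rewrite scalerDr scalerA scalerDl addrACA.
  have [x [c [Xx vE]]] := Yv.
  have c0 : c != 0.
    by apply: contra_not_neq Xv => c0; rewrite vE c0 scale0r add0r.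
  exists c^-1; rewrite vE scalerDr scalerA mulVf // scale1r opprD addrA subrr.
  by rewrite sub0r -scaleNr; exact: XZ'.
have uniq u a b : X (u - a *: v) -> X (u - b *: v) -> a = b.
  move=> Xa Xb; apply/eqP; rewrite -subr_eq0; apply: contrapT => /negP ab0.
  apply: Xv; rewrite -[v]scale1r -(mulVf ab0) -scalerA; apply: XZ'.
  have -> : (a - b) *: v = (-1) *: (u - a *: v) + (u - b *: v).
    by rewrite scaleN1r opprB scalerBl addrA subrK.
  exact: XZ.
pose f (u : V) : K^o := sval (cid (dec u)).
have fP u : X (u - f u *: v) by exact: svalP (cid (dec u)).
exists f => [c x y|].
  apply: (uniq (c *: x + y)) => //.
  rewrite scalerDl -[(c *: f x) *: v]/((c * f x) *: v) -scalerA opprD addrACA.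
  by rewrite -scalerBr; exact: XZ.
by apply: (uniq v) => //; rewrite scale1r subrr.
Qed.

End Functional.

(** * Coproducts of products with primitive factors *)

Section Primitive.
Variables (K : fieldType) (A : lmodType K) (p s : A -> A -> A).
Variable Delta : A -> (A ⊗ A)%type.
Hypothesis bialg : dendriform_bialgebra p s Delta.

Let mul x y := p x y + s x y.

Let mul_bilinear : bilinear mul.
Proof.
have [[pb sb _ _ _] _ _ _ _] := bialg.
by split=> z; [exact: (raw_linear_add (pb.1 z) (sb.1 z))
  | exact: (raw_linear_add (pb.2 z) (sb.2 z))].
Qed.

Let tlift_tens0 (F G : A -> A) : linear F -> linear G ->
  tlift (fun u w => F u ⊗ G w) 0 = 0.
Proof. by move=> lF lG; exact: (tlift0 (bilinear_tens lF lG)). Qed.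

(** The Sweedler sums over Delta x vanish. What remains is a recursion in y, which determines Delta
    on nested products. *)
Lemma dendriform_bialgebra_prec_primitive x y : Delta x = 0 ->
  Delta (p x y) = x ⊗ y + tlift (fun y1 y2 => p x y1 ⊗ y2) (Delta y).
Proof.
have [[pb sb _ _ _] _ _ Dp _] := bialg; move=> Dx; rewrite Dp Dx /=.
rewrite (tlift0 (bilinear_tens_tlift _ pb mul_bilinear)).
rewrite (tlift_tens0 (pb.1 y)) // (tlift_tens0 _ (mul_bilinear.1 y)) //.
by rewrite !addr0.
Qed.

Lemma dendriform_bialgebra_succ_primitive x y : Delta x = 0 -> Delta y = 0 ->
  Delta (s x y) = y ⊗ x.
Proof.
have [[pb sb _ _ _] _ _ _ Ds] := bialg; move=> Dx Dy; rewrite Ds Dx Dy /=.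
rewrite (tlift0 (bilinear_tens_tlift _ sb mul_bilinear)).
rewrite (tlift_tens0 (sb.1 y)) // (tlift_tens0 (sb.2 x)) //.
by rewrite (tlift_tens0 _ (mul_bilinear.2 x)) // !addr0.
Qed.

End Primitive.

(** * Commutativity from the existence of a coproduct *)

Section Converse.
Variables (K : fieldType) (Omega : edsType) (V : lmodType K).
Local Notation gen := (@KSh_gen K Omega V).

(** The functional [psi e] takes the coefficient of e and applies f, with f v = 1, to one-letter
    words. The product of [psi a] and [psi b] is 1 on the left tensor and vanishes on the right one
    unless c = a and d = b. *)
Lemma KSh_gen_tens_inj a b c d v : v != 0 ->
  gen a v ⊗ gen b v = gen c v ⊗ gen d v -> a = c /\ b = d.
Proof.
move=> /exists_functional[f fl fv] eqt.
pose fw (x : tword Omega V) : K^o := if x is tlet u then f u else 0.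
have fw_lin : multilinear fw.
  move=> k x x1 x2 [u u'|e u u' y|e u y y1 y2 _] /=; first exact: fl.
    by rewrite scaler0 addr0.
  by rewrite scaler0 addr0.
pose h (e : Omega) (al : {freeg Omega / K}) (x : Sh Omega V) : K^o :=
  coeff e al * Sh_lift fw x.
have h_bl e : bilinear (h e).
  split=> [x|al] k u u'; rewrite /h.
    by rewrite coeffD coeffZ mulrDl -mulrA.
  by rewrite (Sh_lift_linear fw_lin) mulrDr -[k *: Sh_lift fw u]/(k * _) mulrCA.
pose psi e : KSh Omega V -> K^o := tlift (h e).
have psi_lin e : linear (psi e) by exact: tlift_linear.
have psi_gen e i : psi e (gen i v) = (i == e)%:R.
  rewrite /psi /KSh_gen (tlift_tens _ _ (h_bl e)) /h coeffU mul1r.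
  by rewrite (Sh_lift_word _ fw_lin) /= fv mulr1.
have psi2_bl : bilinear (fun p q => psi a p * psi b q : K^o).
  split=> [q|p] k u u'; rewrite psi_lin.
    by rewrite mulrDl -[k *: psi a u]/(k * _) -mulrA.
  by rewrite mulrDr -[k *: psi b u]/(k * _) mulrCA.
have := congr1 (tlift (fun p q => psi a p * psi b q : K^o)) eqt.
rewrite !(tlift_tens _ _ psi2_bl) !psi_gen !eqxx mulr1 -natrM mulnb.
by case: eqVneq => [->|_]; case: eqVneq => [->|_] //= /eqP; rewrite oner_eq0.
Qed.

Lemma coproduct_commutative (v : V) (Delta : KSh Omega V -> _) : v != 0 ->
  (forall p : Omega * Omega, exists q : Omega * Omega,
     (q.1 ← q.2, q.1 ◁ q.2) = p) ->
  dendriform_bialgebra (@KSh_prec K Omega V) (@KSh_succ K Omega V) Delta ->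
  (forall v a, Delta (gen a v) = 0) -> eds_commutative Omega.
Proof.
move=> v0 surj bialg D0.
have main (a b : Omega) : a → b = b ← a /\ a ▷ b = b ◁ a.
  (* This rewrites the ≻ product of two generators as a ≺ product of two generators, whose coproduct
     is also known. *)
  have [[c e] /= [lE tE]] := surj (a → b, a ▷ b).
  have := dendriform_bialgebra_succ_primitive bialg (D0 v a) (D0 v b).
  rewrite KSh_succ_gen -lE -tE -KSh_prec_gen_word.
  rewrite (dendriform_bialgebra_prec_primitive bialg _ (D0 v c)) D0 tlift0.
    by rewrite addr0 => /(KSh_gen_tens_inj v0)[-> ->].
  apply: (bilinear_tens (G := fun x => x)) => //.
  exact: (KSh_prec_bilinear Omega V).2.
by split=> a b; have [] := main a b.
Qed.

End Converse.

Theorem proposition40 (K : fieldType) (Omega : edsType) (V : lmodType K)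
    (Omega_nondegenerate : eds_nondegenerate Omega)
    (V_nonzero : exists v : V, v != 0) :
  (exists! Delta : KSh Omega V -> tensor (KSh Omega V) (KSh Omega V),
     dendriform_bialgebra (@KSh_prec K Omega V) (@KSh_succ K Omega V) Delta /\
     (forall (v : V) (a : Omega), Delta (KSh_gen a v) = 0))
  <-> eds_commutative Omega.
Proof.
have [[inv Kinv invK] _] := Omega_nondegenerate.
split=> [[Delta [[bialg D0] _]] | comm].
  have [v v0] := V_nonzero; apply: (coproduct_commutative v0 _ bialg D0) => p.
  by exists (inv p); exact: invK.
pose geni (i : Omega * V) := KSh_gen i.1 i.2.
have prec_bl := KSh_prec_bilinear Omega V.
have succE : @KSh_succ K Omega V = fun x y => KSh_prec y x.
  by apply/funext => x; apply/funext => y; exact: KSh_succC.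
have gen_ext (E : lmodType K) := KSh_nested_ext (V := V) invK (E := E).
have prec_gen (i : Omega * V) x y : KSh_prec (KSh_prec (geni i) x) y =
    KSh_prec (geni i) (KSh_prec x y + KSh_prec y x).
  by rewrite KSh_prec_gen KSh_succC.
exists (deconc inv); split; first split.
- rewrite succE; apply: (zinbiel_bialgebra prec_bl prec_gen gen_ext).
  + exact: deconc_linear.
  + exact: deconc_gen.
  + exact: deconc_cons.
- by move=> v a; exact: (deconc_gen inv (a, v)).
(* Any competing coproduct kills the generators, hence obeys the recursion of [deconc]. *)
move=> Delta [bialg D0].
apply: (nested_Delta_unique gen_ext).
- exact: deconc_linear.
- exact: deconc_gen.
- exact: deconc_cons.
- exact: dbi_linear bialg.
- by move=> i; exact: D0.
by move=> i x; exact: (dendriform_bialgebra_prec_primitive bialg _ (D0 _ _)).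
Qed.
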